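(* Let $\kappa$ and $\theta$ be positive integers, let $\Gamma$ be an abelian group, and let $A\subseteq\Gamma$. If $(G,\gamma)\in\mathcal{C}(\kappa,\theta,\Gamma,A)$, then $G$ has no three vertex-disjoint cycles whose $\gamma$-values are in $A$, and if $G$ has two vertex-disjoint cycles whose $\gamma$-values are in $A$, then $(G,\gamma)$ satisfies property (O6b), that is, for a wall $W$ and family $(\mathcal{P}_i: i\in[t])$ of $W$-handlebars witnessing $(G,\gamma)\in\mathcal{C}(\kappa,\theta,\Gamma,A)$, at least one but not all of the $W$-handlebars $\mathcal{P}_i$ are in series.
   Context: General conventions. All graphs are undirected and simple. $[m]$ is the set of positive integers at most $m$. $\langle S\rangle$ is the subgroup generated by $S$, with $\langle\emptyset\rangle=\{0\}$. A $\Gamma$-labelled graph is a pair $(G,\gamma)$ of a graph and a function $\gamma\colon E(G)\to\Gamma$; the $\gamma$-value of a subgraph $H$ is $\gamma(H)=\sum_{e\in E(H)}\gamma(e)$; $H$ is $\gamma$-zero if $\gamma(H)=0$. Paths. An $(X,Y)$-path is a path from a vertex in $X$ to a vertex in $Y$ with no internal vertex in $X\cup Y$; an $X$-path is an $(X,X)$-path with at least one edge; for a subgraph $H$, an $H$-path is a $V(H)$-path. Walls. For integers $c,r\ge 3$, the elementary $(c,r)$-wall $W_{c,r}$ is obtained from the graph on $[2c]\times[r]$ with edge set $\{(i,j)(i+1,j): i\in[2c-1], j\in[r]\}\cup\{(i,j)(i,j+1): i\in[2c], j\in[r-1], i+j\text{ odd}\}$ by deleting both degree-1 vertices. Its $j$-th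 row is the path induced by its vertices $(i,j)$, $i\in[2c]$; its $i$-th column is the path induced by its vertices $(i',j)$ with $i'\in\{2i-1,2i\}$, $j\in[r]$. A $(c,r)$-wall is a subdivision $W$ of $W_{c,r}$; its order is $\min\{c,r\}$. The vertices of $W$ corresponding to vertices of $W_{c,r}$ are its nails; $N^W$ is the set of nails. The subpaths of $W$ corresponding to the $j$-th row and $i$-th column of $W_{c,r}$ are the $j$-th row $R_j^W$ and $i$-th column $C_i^W$ of $W$. The column-boundary of $W$ is the set of endvertices of rows of $W$. A $W$-handle (in a graph containing $W$) is a $W$-path whose endvertices are in the column-boundary of $W$. Handlebars. In a linearly ordered set, disjoint pairs $\{x_1,x_2\}$, $\{y_1,y_2\}$ with $x_1\prec x_2$, $y_1\prec y_2$ are in series if $x_2\prec y_1$ or $y_2\prec x_1$; nested if $x_1\prec y_1\prec y_2\prec x_2$ or $y_1\prec x_1\prec x_2\prec y_2$; crossing otherwise. A set of pairwise disjoint pairs is in series, nested, or crossing if its elements are pairwise so, and pure if it is one of these. For a $(c,r)$-wall $W$, $\prec_W$ is the linear order on the column-boundary with $v\prec_W w$ if: $v$ is in the first column and $w$ in the last column; or both are in the first column and the row index of $v$ is lower than that of $w$; or both are in the last column and the row index of $v$ is higher than that of $w$. A set of $W$-handles is pure, nested, in series, or crossing if the set of its pairs of endvertices is so with respect to $\prec_W$. A $W$-handlebar is a pure set $\mathcal{P}$ of pairwise vertex-disjoint $W$-handles such that there are two paths $X,Y$ in $C_1^W\cup C_c^W$ for which each $P\in\mathcal{P}$ is a $(V(X),V(Y))$-path.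 Two $W$-handlebars $\mathcal{P}_1,\mathcal{P}_2$ are non-mixing if for each $i\in[2]$ there are (not necessarily disjoint) paths $X_i,Y_i$ in $C_1^W\cup C_c^W$ such that $\mathcal{P}_i$ is a set of $(V(X_i),V(Y_i))$-paths and $X_1\cup Y_1$ and $X_2\cup Y_2$ are vertex-disjoint. For a set $\mathcal{P}$ of graphs, $\bigcup\mathcal{P}$ is their union; two sets of graphs are vertex-disjoint if their unions are. The class $\mathcal{C}$. For positive integers $\kappa,\theta$, an abelian group $\Gamma$, and $A\subseteq\Gamma$, $\mathcal{C}(\kappa,\theta,\Gamma,A)$ is the class of all $\Gamma$-labelled graphs $(G,\gamma)$ having a wall $W$ of order at least $\theta$ and a nonempty family $(\mathcal{P}_i: i\in[t])$ of pairwise vertex-disjoint non-mixing $W$-handlebars, each of size at least $\kappa$, such that: (O1) $G$ is the union of $W$ and $\bigcup\{\bigcup\mathcal{P}_i: i\in[t]\}$; (O2) every $N^W$-path in $W$ is $\gamma$-zero; (O3) $\sum_{i\in[t]}\gamma(P_i)\in A$ for any family $(P_i: i\in[t])$ with $P_i\in\mathcal{P}_i$ for all $i\in[t]$; (O4) for each $i\in[t]$, $\langle\gamma(P): P\in\bigcup_{j\in[t]\setminus\{i\}}\mathcal{P}_j\rangle\cap A=\emptyset$; (O5) if $\sum_{j\in[t]}\sum_{P\in\mathcal{P}_j}f(P)\gamma(P)\in A$ for a function $f\colon\bigcup_{j\in[t]}\mathcal{P}_j\to\mathbb{Z}$, then for each $i\in[t]$, $\mathcal{P}_i$ is in series or $\sum_{P\in\mathcal{P}_i}f(P)$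 is odd; and (O6) at least one of the following holds: (O6a) the number of crossing $W$-handlebars in $(\mathcal{P}_i: i\in[t])$ is odd; (O6b) at least one but not all $W$-handlebars in $(\mathcal{P}_i: i\in[t])$ are in series; (O6c) at least three $W$-handlebars in $(\mathcal{P}_i: i\in[t])$ are in series. *)

(* Defs.v *)
From HB Require Import structures.
From mathcomp Require Import all_boot all_order all_algebra.
From mathcomp Require Import boolp.

Set Implicit Arguments.
Unset Strict Implicit.
Unset Printing Implicit Defensive.

Import GRing.Theory.

(* Finite simple graphs are pairs (V(G), E(G)) living inside an ambient finite
   type, so that a subgraph of a graph, a path and a cycle are objects of the
   same type.  An edge is the two-element set of its ends. *)
Definition graph_axiom (V : finType) (g : {set V} * {set {set V}}) : bool :=
  [forall e in g.2, (#|e| == 2) && (e \subset g.1)].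

Record sgraph (V : finType) :=
  SGraph { graph_data : {set V} * {set {set V}}; _ : graph_axiom graph_data }.

HB.instance Definition _ (V : finType) := [isSub for @graph_data V].
HB.instance Definition _ (V : finType) := [Finite of sgraph V by <:].

Definition vset (V : finType) (G : sgraph V) : {set V} := (graph_data G).1.
Definition eset (V : finType) (G : sgraph V) : {set {set V}} := (graph_data G).2.

Lemma edgeP (V : finType) (G : sgraph V) (e : {set V}) :
  e \in eset G -> #|e| = 2 /\ e \subset vset G.
Proof.
by move=> he; move: (valP G) => /forall_inP /(_ _ he) /andP[/eqP].
Qed.

Definition subgraph (V : finType) (H G : sgraph V) : bool :=
  (vset H \subset vset G) && (eset H \subset eset G).

Definition degree (V : finType) (G : sgraph V) (v : V) : nat :=
  #|[set e in eset G | v \in e]|.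

Definition vdisjoint (V : finType) (G H : sgraph V) : bool :=
  [disjoint vset G & vset H].

Lemma edgeless_subproof (V : finType) (S : {set V}) :
  graph_axiom (S, set0 : {set {set V}}).
Proof. by apply/forall_inP => e; rewrite inE. Qed.

Definition edgeless (V : finType) (S : {set V}) : sgraph V :=
  SGraph (edgeless_subproof S).

Lemma graphs_union_subproof (V : finType) (Gs : {set sgraph V}) :
  graph_axiom (\bigcup_(G in Gs) vset G, \bigcup_(G in Gs) eset G).
Proof.
apply/forall_inP => e /bigcupP[G hG /edgeP[-> he]]; rewrite eqxx /=.
exact: subset_trans he (bigcup_sup G hG).
Qed.

Definition graphs_union (V : finType) (Gs : {set sgraph V}) : sgraph V :=
  SGraph (graphs_union_subproof Gs).

Definition graph_union (V : finType) (G H : sgraph V) : sgraph V :=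
  graphs_union [set G; H].

Lemma induced_subproof (V : finType) (G : sgraph V) (S : {set V}) :
  graph_axiom (vset G :&: S, [set e in eset G | e \subset S]).
Proof.
apply/forall_inP => e; rewrite inE => /andP[/edgeP[-> hG] hS].
by rewrite eqxx subsetI hG hS.
Qed.

Definition induced (V : finType) (G : sgraph V) (S : {set V}) : sgraph V :=
  SGraph (induced_subproof G S).

Definition path_along (V : finType) (P : sgraph V) (x : V) (p : seq V) : Prop :=
  [/\ uniq (x :: p), vset P = [set:: x :: p]
    & eset P = [set:: [seq [set e.1; e.2] | e <- zip (x :: p) p]]].

Definition path_between (V : finType) (P : sgraph V) (x y : V) : Prop :=
  exists2 p, path_along P x p & last x p = y.

Definition is_path (V : finType) (P : sgraph V) : Prop :=
  exists x y, path_between P x y.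

Definition endvertices (V : finType) (P : sgraph V) : {set V} :=
  [set x | `[< exists y, path_between P x y >]].

Definition is_cycle (V : finType) (C : sgraph V) : Prop :=
  exists s : seq V, [/\ uniq s, 3 <= size s, vset C = [set:: s]
    & eset C = [set:: [seq [set e.1; e.2] | e <- zip s (rot 1 s)]]].

Definition XY_path (V : finType) (X Y : {set V}) (P : sgraph V) : Prop :=
  exists x y, [/\ path_between P x y, x \in X, y \in Y
    & forall v, v \in vset P -> v != x -> v != y -> v \notin X :|: Y].

Definition X_path (V : finType) (X : {set V}) (P : sgraph V) : Prop :=
  XY_path X X P /\ eset P != set0.

(* The graph on [2c] x [r] is indexed from 0; shifting both coordinates by one
   does not change the parity of i + j. *)
Definition brick_adj (c r : nat) (u v : 'I_c.*2 * 'I_r) : bool :=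
  ((u.2 == v.2) && (u.1.+1 == v.1 :> nat)) ||
  [&& u.1 == v.1, u.2.+1 == v.2 :> nat & odd (u.1 + u.2)].

Lemma brick_subproof (c r : nat) :
  graph_axiom ([set: 'I_c.*2 * 'I_r],
    [set [set e.1; e.2] | e : ('I_c.*2 * 'I_r) * ('I_c.*2 * 'I_r)
                        & brick_adj e.1 e.2]).
Proof.
apply/forall_inP => _ /imsetP[[u v] /= huv ->]; rewrite subsetT andbT cards2.
suff -> : u != v by [].
move: huv; rewrite inE /= => huv; apply/eqP => E; move: huv.
by rewrite E /brick_adj !eqn_leq !ltnn !andbF.
Qed.

Definition brick_graph (c r : nat) : sgraph ('I_c.*2 * 'I_r)%type :=
  SGraph (brick_subproof c r).

Definition elementary_wall (c r : nat) : sgraph ('I_c.*2 * 'I_r)%type :=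
  induced (brick_graph c r) [set u | degree (brick_graph c r) u != 1].

(* Rows and columns are also indexed from 0: the first column has index 0 and
   the last one has index c.-1. *)
Definition elementary_row (c r j : nat) : sgraph ('I_c.*2 * 'I_r)%type :=
  induced (elementary_wall c r) [set u : 'I_c.*2 * 'I_r | u.2 == j :> nat].

Definition elementary_column (c r i : nat) : sgraph ('I_c.*2 * 'I_r)%type :=
  induced (elementary_wall c r) [set u : 'I_c.*2 * 'I_r | (u.1)./2 == i].

(* A subdivision of H inside V comes with the vertices and paths that
   correspond to the vertices and edges of H; the values of sd_vertex outside
   V(H) and of sd_path outside E(H) are irrelevant. *)
Record subdivision (U V : finType) (H : sgraph U) := Subdivision {
  sd_vertex : U -> V;
  sd_path : {set U} -> sgraph V;
  sd_vertex_inj : {in vset H &, injective sd_vertex};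
  sd_pathP : forall u v, [set u; v] \in eset H ->
    path_between (sd_path [set u; v]) (sd_vertex u) (sd_vertex v);
  sd_path_branch : forall e, e \in eset H ->
    vset (sd_path e) :&: (sd_vertex @: vset H) = sd_vertex @: e;
  sd_path_disjoint : forall e f, e \in eset H -> f \in eset H -> e != f ->
    vset (sd_path e) :&: vset (sd_path f) \subset sd_vertex @: vset H
}.

Definition sd_image (U V : finType) (H : sgraph U) (S : subdivision V H)
    (K : sgraph U) : sgraph V :=
  graph_union (edgeless (sd_vertex S @: vset K))
              (graphs_union [set sd_path S e | e in eset K]).

Record wall (V : finType) := Wall {
  wcols : nat;
  wrows : nat;
  wcols_ge3 : 3 <= wcols;
  wrows_ge3 : 3 <= wrows;
  wsub : subdivision V (elementary_wall wcols wrows)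
}.

Definition wgraph (V : finType) (W : wall V) : sgraph V :=
  sd_image (wsub W) (elementary_wall (wcols W) (wrows W)).

Definition worder (V : finType) (W : wall V) : nat := minn (wcols W) (wrows W).

Definition nails (V : finType) (W : wall V) : {set V} :=
  sd_vertex (wsub W) @: vset (elementary_wall (wcols W) (wrows W)).

Definition wrow (V : finType) (W : wall V) (j : nat) : sgraph V :=
  sd_image (wsub W) (elementary_row (wcols W) (wrows W) j).

Definition wcol (V : finType) (W : wall V) (i : nat) : sgraph V :=
  sd_image (wsub W) (elementary_column (wcols W) (wrows W) i).

Definition first_col (V : finType) (W : wall V) : sgraph V := wcol W 0.
Definition last_col (V : finType) (W : wall V) : sgraph V :=
  wcol W (wcols W).-1.

Definition column_boundary (V : finType) (W : wall V) : {set V} :=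
  \bigcup_(j < wrows W) endvertices (wrow W j).

Definition handle (V : finType) (W : wall V) (P : sgraph V) : Prop :=
  X_path (vset (wgraph W)) P /\ endvertices P \subset column_boundary W.

Definition wall_lt (V : finType) (W : wall V) (v w : V) : bool :=
  [&& v \in column_boundary W, w \in column_boundary W &
    [exists j : 'I_(wrows W), exists k : 'I_(wrows W),
      [&& v \in vset (wrow W j), w \in vset (wrow W k) &
        [|| (v \in vset (first_col W)) && (w \in vset (last_col W)),
            [&& v \in vset (first_col W), w \in vset (first_col W) & j < k]
          | [&& v \in vset (last_col W), w \in vset (last_col W) & k < j]]]]].

Definition pairs_in_series (V : finType) (lt : rel V) (p q : {set V}) : Prop :=
  exists x1 x2 y1 y2, [/\ p = [set x1; x2], q = [set y1; y2], lt x1 x2, lt y1 y2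
    & lt x2 y1 \/ lt y2 x1].

Definition pairs_nested (V : finType) (lt : rel V) (p q : {set V}) : Prop :=
  exists x1 x2 y1 y2, [/\ p = [set x1; x2], q = [set y1; y2], lt x1 x2, lt y1 y2
    & [/\ lt x1 y1, lt y1 y2 & lt y2 x2] \/ [/\ lt y1 x1, lt x1 x2 & lt x2 y2]].

Definition pairs_crossing (V : finType) (lt : rel V) (p q : {set V}) : Prop :=
  ~ pairs_in_series lt p q /\ ~ pairs_nested lt p q.

Definition pairwise_on (T : finType) (R : T -> T -> Prop) (S : {set T}) : Prop :=
  forall p q, p \in S -> q \in S -> p != q -> R p q.

Definition end_pairs (V : finType) (Ps : {set sgraph V}) : {set {set V}} :=
  [set endvertices P | P in Ps].

Definition in_series (V : finType) (W : wall V) (Ps : {set sgraph V}) : Prop :=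
  pairwise_on (pairs_in_series (wall_lt W)) (end_pairs Ps).

Definition nested (V : finType) (W : wall V) (Ps : {set sgraph V}) : Prop :=
  pairwise_on (pairs_nested (wall_lt W)) (end_pairs Ps).

Definition crossing (V : finType) (W : wall V) (Ps : {set sgraph V}) : Prop :=
  pairwise_on (pairs_crossing (wall_lt W)) (end_pairs Ps).

Definition pure (V : finType) (W : wall V) (Ps : {set sgraph V}) : Prop :=
  [\/ in_series W Ps, nested W Ps | crossing W Ps].

Definition boundary_path (V : finType) (W : wall V) (X : sgraph V) : Prop :=
  is_path X /\ subgraph X (graph_union (first_col W) (last_col W)).

Definition handlebar (V : finType) (W : wall V) (Ps : {set sgraph V}) : Prop :=
  [/\ forall P, P \in Ps -> handle W P,
      pairwise_on (@vdisjoint V) Ps,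
      pure W Ps
    & exists X Y, [/\ boundary_path W X, boundary_path W Y
        & forall P, P \in Ps -> XY_path (vset X) (vset Y) P]].

Definition non_mixing (V : finType) (W : wall V) (Ps Qs : {set sgraph V}) :
    Prop :=
  exists X1 Y1 X2 Y2,
    [/\ [/\ boundary_path W X1, boundary_path W Y1,
            boundary_path W X2 & boundary_path W Y2],
        forall P, P \in Ps -> XY_path (vset X1) (vset Y1) P,
        forall Q, Q \in Qs -> XY_path (vset X2) (vset Y2) Q
      & vdisjoint (graph_union X1 Y1) (graph_union X2 Y2)].

(* A labelling is a total function on sets of vertices, of which only the
   values on E(G) are used. *)
Definition gvalue (V : finType) (Gamma : zmodType) (gamma : {set V} -> Gamma)
    (H : sgraph V) : Gamma :=
  (\sum_(e in eset H) gamma e)%R.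

Definition generated (Gamma : zmodType) (S : Gamma -> Prop) (x : Gamma) : Prop :=
  forall H : Gamma -> Prop,
    H 0%R -> (forall a b, H a -> H b -> H (a - b)%R) ->
    (forall s, S s -> H s) -> H x.

Definition O1 (V : finType) (G : sgraph V) (W : wall V) (t : nat)
    (Ps : 'I_t -> {set sgraph V}) : Prop :=
  G = graph_union (wgraph W) (graphs_union [set graphs_union (Ps i) | i : 'I_t]).

Definition O2 (V : finType) (Gamma : zmodType) (gamma : {set V} -> Gamma)
    (W : wall V) : Prop :=
  forall P, subgraph P (wgraph W) -> X_path (nails W) P -> gvalue gamma P = 0%R.

Definition O3 (V : finType) (Gamma : zmodType) (A : Gamma -> Prop)
    (gamma : {set V} -> Gamma) (t : nat) (Ps : 'I_t -> {set sgraph V}) : Prop :=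
  forall P : 'I_t -> sgraph V, (forall i, P i \in Ps i) ->
    A (\sum_(i < t) gvalue gamma (P i))%R.

Definition O4 (V : finType) (Gamma : zmodType) (A : Gamma -> Prop)
    (gamma : {set V} -> Gamma) (t : nat) (Ps : 'I_t -> {set sgraph V}) : Prop :=
  forall (i : 'I_t) (x : Gamma),
    generated
      (fun g => exists j P, [/\ j != i, P \in Ps j & g = gvalue gamma P]) x ->
    ~ A x.

Definition O5 (V : finType) (Gamma : zmodType) (A : Gamma -> Prop)
    (gamma : {set V} -> Gamma) (W : wall V) (t : nat)
    (Ps : 'I_t -> {set sgraph V}) : Prop :=
  forall f : sgraph V -> int,
    A (\sum_(j < t) \sum_(P in Ps j) gvalue gamma P *~ f P)%R ->
    forall i : 'I_t, in_series W (Ps i) \/ odd `|(\sum_(P in Ps i) f P)%R|%N.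

Definition O6a (V : finType) (W : wall V) (t : nat)
    (Ps : 'I_t -> {set sgraph V}) : Prop :=
  odd #|[set i | `[< crossing W (Ps i) >]]|.

Definition O6b (V : finType) (W : wall V) (t : nat)
    (Ps : 'I_t -> {set sgraph V}) : Prop :=
  (exists i, in_series W (Ps i)) /\ ~ (forall i, in_series W (Ps i)).

Definition O6c (V : finType) (W : wall V) (t : nat)
    (Ps : 'I_t -> {set sgraph V}) : Prop :=
  3 <= #|[set i | `[< in_series W (Ps i) >]]|.

Definition witness (kappa theta : nat) (V : finType) (Gamma : zmodType)
    (A : Gamma -> Prop) (G : sgraph V) (gamma : {set V} -> Gamma)
    (W : wall V) (t : nat) (Ps : 'I_t -> {set sgraph V}) : Prop :=
  [/\ theta <= worder W,
      [/\ 0 < t,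
          forall i, handlebar W (Ps i) /\ kappa <= #|Ps i|,
          forall i j, i != j ->
            vdisjoint (graphs_union (Ps i)) (graphs_union (Ps j))
        & forall i j, i != j -> non_mixing W (Ps i) (Ps j)]
    & [/\ O1 G W Ps, O2 gamma W, O3 A gamma Ps, O4 A gamma Ps
        & O5 A gamma W Ps /\ [\/ O6a W Ps, O6b W Ps | O6c W Ps]]].

Definition class_C (kappa theta : nat) (V : finType) (Gamma : zmodType)
    (A : Gamma -> Prop) (G : sgraph V) (gamma : {set V} -> Gamma) : Prop :=
  exists (W : wall V) (t : nat) (Ps : 'I_t -> {set sgraph V}),
    witness kappa theta A G gamma W Ps.

Definition disjoint_A_cycles (k : nat) (V : finType) (Gamma : zmodType)
    (A : Gamma -> Prop) (G : sgraph V) (gamma : {set V} -> Gamma) : Prop :=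
  exists C : 'I_k -> sgraph V,
    (forall i, [/\ is_cycle (C i), subgraph (C i) G & A (gvalue gamma (C i))])
    /\ (forall i j, i != j -> vdisjoint (C i) (C j)).

(* Main.v *)
Require Import Defs.
From mathcomp Require Import all_boot all_order all_algebra.
From mathcomp Require Import boolp zify.

(* Everything is a parity argument. By O2-O4 an A-cycle C is a union of wall
   paths and of entire handles, at least one from every handlebar, and by O5 it
   uses an odd number of handles of every handlebar that is not in series.

   Planarity of the wall enters through ray casting: the part of C inside the
   wall defines a 0/1-potential on the vertices off C that is constant along
   the wall edges avoiding C, and whose value at an end u of a row is the parity
   of the number of handle ends of C that precede u on the column boundary.
   Hence the same parity is constant along any connected subgraph disjoint from
   C, up to its jumps at handles, and these count crossings of handles, which
   by the non-mixing condition depend only on the handlebars involved.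

   - If no handlebar is in series, the total number of crossings between the
     handles of two disjoint A-cycles is even and has the parity of the number
     of crossing handlebars, against O6a.
   - If all handlebars are in series and there are three of them, take the
     potential of an arc of one cycle joining two of its handles: it is constant
     on the other cycle, which is impossible for all three pairs of handlebars.
   - If there is a handlebar in series and one that is not, three disjoint
     A-cycles are excluded by counting, for each cycle, on which side of the sum
     of the two others it lies: seen from the handlebar that is not in series,
     an odd number of the three sides is 1, and seen from the other one an even
     number. *)

Set Implicit Arguments.
Unset Strict Implicit.
Unset Printing Implicit Defensive.

Import GRing.Theory.

(** * Paths and cycles *)

Section PathEdges.
Variable V : finType.
Implicit Types (x y v : V) (p q s : seq V) (P C Z : sgraph V).

Definition path_edges x p : seq {set V} :=
  [seq [set e.1; e.2] | e <- zip (x :: p) p].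

Lemma path_edges_cons x y p :
  path_edges x (y :: p) = [set x; y] :: path_edges y p.
Proof. by []. Qed.

Lemma path_edges_rcons x p y :
  path_edges x (rcons p y) = rcons (path_edges x p) [set last x p; y].
Proof.
elim: p x => [|z p IH] x //.
by rewrite rcons_cons !path_edges_cons IH.
Qed.

Lemma path_edges_sub x p e v : e \in path_edges x p -> v \in e -> v \in x :: p.
Proof.
elim: p x => [|y p IH] x //; rewrite path_edges_cons inE => /orP[/eqP->|].
  by rewrite !inE => /orP[]->; rewrite ?orbT.
by move=> /IH h /h hv; rewrite inE hv orbT.
Qed.

Lemma path_edges_rev x p :
  path_edges (last x p) (rev (belast x p)) = rev (path_edges x p).
Proof.
elim: p x => [|y p IH] x //.
rewrite path_edges_cons rev_cons -IH /= rev_cons path_edges_rcons; congr rcons.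
suff -> : last (last y p) (rev (belast y p)) = y by rewrite setUC.
by case: p {IH} => //= z p; rewrite rev_cons last_rcons.
Qed.

Lemma path_between_sym P x y : path_between P x y -> path_between P y x.
Proof.
case=> p [pU pV pE] ly; have E : y :: rev (belast x p) = rev (x :: p).
  by rewrite (lastI x p) rev_rcons ly.
exists (rev (belast x p)); last first.
  by rewrite -ly; case: (p) => //= z q; rewrite rev_cons last_rcons.
split; first by rewrite E rev_uniq.
  by rewrite E pV; apply/setP=> v; rewrite !inE mem_rev inE.
have := path_edges_rev x p; rewrite ly /path_edges => ->.
by rewrite pE; apply/setP=> v; rewrite !inE mem_rev.
Qed.

Lemma path_edges_uniq x p : uniq (x :: p) -> uniq (path_edges x p).
Proof.
elim: p x => [|y p IH] x // /andP[xp yU]; rewrite path_edges_cons /= IH // andbT.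
apply/negP => /path_edges_sub /(_ (set21 _ _)); by rewrite (negbTE xp).
Qed.

(** Every vertex but the last begins one edge and every vertex but the first finishes one; degrees
    in a path follow from this count. *)
Lemma count_path_edges x p v : uniq (x :: p) ->
  count (fun e : {set V} => v \in e) (path_edges x p) = (v \in belast x p) + (v \in p).
Proof.
elim: p x => [|y p IH] x // /andP[xp yU]; rewrite path_edges_cons /= IH //.
have xb : x \notin belast y p by apply: contra xp; exact: mem_belast.
have yp : y \notin p by case/andP: yU.
have xy : x != y by move: xp; rewrite inE negb_or => /andP[].
rewrite !inE; case: (eqVneq v x) => [->|vx] /=.
  by rewrite (negbTE xb) (negbTE xy) add0n addnC.
by case: (eqVneq v y) => [->|vy] /=; rewrite ?(negbTE yp) ?addn0 // addnC.
Qed.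

Lemma path_degree P x p v : path_along P x p ->
  degree P v = (v \in belast x p) + (v \in p).
Proof.
case=> pU pV pE; rewrite -count_path_edges // /degree pE.
have -> : [set e in [set:: [seq [set e.1; e.2] | e <- zip (x :: p) p]] | v \in e]
   = [set:: [seq e : {set V} <- path_edges x p | v \in e]].
  by apply/setP => e; rewrite !inE mem_filter andbC.
by rewrite cardsE (card_uniqP _) ?size_filter // filter_uniq // path_edges_uniq.
Qed.

Lemma path_degree_le2 P v : is_path P -> degree P v <= 2.
Proof. by case=> x [y [p /path_degree -> _]]; case: (_ \in _); case: (_ \in _). Qed.

Lemma path_degree_internal P x y v : path_between P x y -> v \in vset P ->
  v != x -> v != y -> degree P v = 2.
Proof.
case=> p pP ly vP vx vy; rewrite (path_degree v pP).
case: pP => _ E _; move: vP; rewrite E inE => vxp.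
have -> : v \in p by move: vxp; rewrite inE (negbTE vx).
by move: vxp; rewrite lastI mem_rcons inE ly (negbTE vy) /= => ->.
Qed.

Lemma path_degree_end_le1 P x y : path_between P x y -> degree P x <= 1.
Proof.
case=> p pP ly; rewrite (path_degree x pP).
by case: pP => /andP[/negbTE-> _] _ _; rewrite addn0; case: (_ \in _).
Qed.

Lemma path_degree_end P x y : path_between P x y -> x != y -> degree P x = 1.
Proof.
case=> p pP ly xy; rewrite (path_degree x pP).
case: pP => /andP[/negbTE-> _] _ _; rewrite addn0.
by case: p ly => [E|z p _]; [rewrite -E eqxx in xy|rewrite /= mem_head].
Qed.

Lemma path_between_mem P x y : path_between P x y -> (x \in vset P) * (y \in vset P).
Proof. by case=> p [_ -> _] <-; rewrite !in_set mem_head mem_last. Qed.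

(** The degree detects the ends: the first vertex of any traversal has degree at most 1, an internal
    vertex degree 2. *)
Lemma endvertices_path P x y : path_between P x y -> endvertices P = [set x; y].
Proof.
move=> Pxy; apply/setP => z; rewrite !inE; apply/asboolP/idP; last first.
  by case/orP=> /eqP->; [exists y|exists x; exact: path_between_sym].
case=> w Pzw; apply: contraT; rewrite negb_or => /andP[zx zy].
have := path_degree_end_le1 Pzw.
by rewrite (path_degree_internal Pxy) // (path_between_mem Pzw).
Qed.

Lemma path_between_ends P x y x' y' : path_between P x y -> path_between P x' y' ->
  [set x; y] = [set x'; y'].
Proof. by move=> /endvertices_path <- /endvertices_path. Qed.

Lemma zip_rot (T S : Type) n (s : seq T) (t : seq S) : size s = size t ->
  zip (rot n s) (rot n t) = rot n (zip s t).
Proof.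
move=> E; rewrite /rot zip_cat ?size_drop ?E //; congr cat.
  by elim: n s t E => [|n IH] [|a s] [|b t] //= [E]; exact: IH.
by elim: n s t E => [|n IH] [|a s] [|b t] //= [E]; rewrite IH.
Qed.

Lemma zip_rot1 (T : Type) (z : T) t :
  zip (z :: t) (rot 1 (z :: t)) = zip (z :: rcons t z) (rcons t z).
Proof.
rewrite rot1_cons.
have H (w : T) : zip (w :: t) (rcons t z) = zip (w :: rcons t z) (rcons t z).
  by elim: t w => [|t0 t IH] w //=; congr cons; exact: IH.
exact: H.
Qed.

(** Rotating the vertex sequence to [v] exhibits the cycle as a path plus a closing edge, with both
    edges at [v] visible. *)
Lemma cycle_rooted C v : is_cycle C -> v \in vset C ->
  exists a q b, [/\ uniq (v :: a :: rcons q b), vset C = [set:: v :: a :: rcons q b] &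
     eset C = [set:: [set v; a] :: rcons (path_edges a (rcons q b)) [set b; v]]].
Proof.
case=> s [sU s3 sV sE] vC; have /rot_to[i s' E] : v \in s by move: vC; rewrite sV inE.
have s'3 : 3 <= size (v :: s') by rewrite -E size_rot.
have s'U : uniq (v :: s') by rewrite -E rot_uniq.
have sV' : vset C = [set:: v :: s'] by rewrite sV -E; apply/setP=> z; rewrite !inE mem_rot.
have sE' : eset C = [set:: [seq [set e.1; e.2] | e <- zip (v :: s') (rot 1 (v :: s'))]].
  rewrite sE -E rot_rot zip_rot ?size_rot // map_rot.
  by apply/setP => z; rewrite !inE mem_rot.
case: s' s'3 s'U sV' sE' {E} => [|a s'] //; case: (lastP s') => [|q b] // _ U EV EE.
exists a, q, b; split=> //; rewrite EE zip_rot1 -/(path_edges _ _).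
by rewrite path_edges_rcons path_edges_cons /= last_rcons.
Qed.

Lemma cycle_degree C v : is_cycle C -> v \in vset C -> degree C v = 2.
Proof.
move=> hC vC; have [a [q [b [U EV EE]]]] := cycle_rooted hC vC.
rewrite /degree EE.
have vn : v \notin a :: rcons q b by case/andP: U.
have -> : [set e in [set:: [set v; a] :: rcons (path_edges a (rcons q b)) [set b; v]] | v \in e]
   = [set [set v; a]; [set b; v]].
  apply/setP => e; rewrite !inE mem_rcons inE.
  case: (eqVneq e [set v; a]) => [->|_] /=; first by rewrite set21.
  case: (eqVneq e [set b; v]) => [->|_] /=; first by rewrite set22.
  by apply/negP=> /andP[/path_edges_sub h /h]; rewrite (negbTE vn).
rewrite cards2; suff -> : [set v; a] != [set b; v] by [].
apply/eqP => /setP /(_ a); rewrite !inE eqxx orbT => /esym/orP[]/eqP E.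
  by move: U; rewrite E /= mem_rcons mem_head andbF.
by move: vn; rewrite -E mem_head.
Qed.

(** Connectedness as an induction principle: an invariant checked on edges passes between any two
    vertices, with no walk to be exhibited. *)
Definition connected_sg Z : Prop :=
  forall S : V -> Prop, (forall a b, [set a; b] \in eset Z -> S a -> S b) ->
  forall u v, u \in vset Z -> v \in vset Z -> S u -> S v.

Lemma path_along_connected Z x p : vset Z = [set:: x :: p] ->
  {subset path_edges x p <= eset Z} -> connected_sg Z.
Proof.
move=> EV EE S hS u v; rewrite EV !inE -!/(_ \in x :: p).
suff H w : w \in x :: p -> (S w <-> S x).
  by move=> /H Hu /H Hv /Hu /Hv.
elim: p x EE {EV} w => [|y p IH] x EE w; first by rewrite inE => /eqP->.
rewrite inE => /orP[/eqP->//|wp].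
have e : [set x; y] \in eset Z by apply: EE; rewrite path_edges_cons mem_head.
have Sxy : S x <-> S y by split; apply: hS; rewrite // setUC.
rewrite Sxy; apply: IH => // f hf; apply: EE.
by rewrite path_edges_cons inE hf orbT.
Qed.

Lemma path_connected Z : is_path Z -> connected_sg Z.
Proof.
case=> x [y [p [U EV EE] _]]; apply: (path_along_connected EV) => e.
by rewrite EE inE.
Qed.

Lemma cycle_nonempty C : is_cycle C -> exists v, v \in vset C.
Proof. by case=> [[|v s]] [] // _ _ -> _; exists v; rewrite inE mem_head. Qed.

Lemma cycle_connected C : is_cycle C -> connected_sg C.
Proof.
move=> hC; have [v vC] := cycle_nonempty hC.
have [a [q [b [U EV EE]]]] := cycle_rooted hC vC.
apply: (path_along_connected EV) => e; rewrite EE !inE mem_rcons inE.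
by case/orP=> ->; rewrite ?orbT.
Qed.

Lemma incident_in_vset P e v : e \in eset P -> v \in e -> v \in vset P.
Proof. by case/edgeP=> _ /subsetP h /h. Qed.

Lemma edge_pair P e : e \in eset P -> exists a b, a != b /\ e = [set a; b].
Proof. by case/edgeP=> /eqP/cards2P[a [b [ab ->]]] _; exists a, b. Qed.

(** Consecutive edges share an internal vertex, so a property that crosses internal vertices spreads
    over the path. *)
Lemma path_edges_all P x y (T : {set V} -> Prop) : path_between P x y ->
  (forall v e f, v \in vset P -> v != x -> v != y ->
     e \in eset P -> f \in eset P -> v \in e -> v \in f -> T e -> T f) ->
  forall e f, e \in eset P -> f \in eset P -> T e -> T f.
Proof.
case=> p [U EV EE] ly hT.
have {}hT v e f : v \in p -> v != last x p -> e \in path_edges x p ->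
    f \in path_edges x p -> v \in e -> v \in f -> T e -> T f.
  move=> vp vl he hf; apply: hT; rewrite ?EV ?EE ?inE ?vp ?orbT -?ly //.
  by apply: contraTneq vp => ->; case/andP: U.
suff H e f : e \in path_edges x p -> f \in path_edges x p -> T e -> T f.
  by move=> e f; rewrite EE !inE => he hf; exact: H.
have {U EV EE ly} : uniq (x :: p) by [].
elim: p x hT e f => [|z p IH] x hT e f U //.
have {}IH e' f' : e' \in path_edges z p -> f' \in path_edges z p -> T e' -> T f'.
  apply: IH; last by case/andP: U.
  move=> v e1 f1 vp vl he1 hf1; apply: (hT v) => //;
    by rewrite ?path_edges_cons inE ?vp ?he1 ?hf1 orbT.
case: p U hT IH => [|w p] U hT IH.
  by rewrite !path_edges_cons /= !inE => /eqP-> /eqP->.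
have zl : z != last x [:: z, w & p].
  case/and3P: U => _ zn _ /=; apply: contra zn => /eqP E; rewrite {1}E; exact: mem_last.
have Hz e' f' := hT z e' f' (mem_head _ _) zl.
have m0 : [set x; z] \in path_edges x [:: z, w & p] by rewrite path_edges_cons mem_head.
have m1 : [set z; w] \in path_edges x [:: z, w & p].
  by rewrite !path_edges_cons !inE eqxx orbT.
have m2 : [set z; w] \in path_edges z (w :: p) by rewrite path_edges_cons mem_head.
rewrite [path_edges x _]path_edges_cons 2!in_cons.
case/orP=> [/eqP->|he]; case/orP=> [/eqP->|hf] //.
- by move=> Te; apply: (IH [set z; w]) => //; apply: Hz m0 m1 _ _ Te; rewrite ?set21 ?set22.
- move=> Te; have {}Te : T [set z; w] by exact: IH Te.
  by apply: Hz m1 m0 _ _ Te; rewrite ?set21 ?set22.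
- exact: IH.
Qed.

End PathEdges.

(** * Systems of links *)

(* A subdivided multigraph: the links are the subdivided edges, and N contains
   the branch vertices. *)
Record link_system (V : finType) (G : sgraph V) (Ls : {set sgraph V})
    (N : {set V}) : Prop := LinkSystem {
  link_path : forall L, L \in Ls ->
    exists x y, [/\ path_between L x y, x != y & vset L :&: N = [set x; y]];
  link_meet : forall L M, L \in Ls -> M \in Ls -> L != M ->
    vset L :&: vset M \subset N;
  link_edges : forall L M e, L \in Ls -> M \in Ls -> e \in eset L ->
    e \in eset M -> L = M;
  link_cover : forall e, e \in eset G -> exists2 L, L \in Ls & e \in eset L
}.

Section LinkSystems.
Variables (V : finType) (G : sgraph V) (Ls : {set sgraph V}) (N : {set V}).
Hypothesis sys : link_system G Ls N.
Implicit Types (L M C Z : sgraph V).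

(** A vertex outside [N] lies on only one link, so [Z] changes links only at branch vertices;
    between two of these it stays in one link, where the hypothesis on [K] applies. *)
Lemma connected_links Z (K : V -> Prop) : connected_sg Z -> subgraph Z G ->
  (forall L a b, L \in Ls -> a \in vset L -> b \in vset L -> a \in N -> b \in N ->
     a \in vset Z -> b \in vset Z -> K a -> K b) ->
  forall u v, u \in N -> v \in N -> u \in vset Z -> v \in vset Z -> K u -> K v.
Proof.
move=> Zc /andP[_ /subsetP ZG] HK u v uN vN uZ vZ Ku.
(* Off [N] the invariant records a branch vertex on the same link that [Z] contains and that
   satisfies [K]. *)
pose S x := x \in vset Z /\ ((x \in N -> K x) /\
  (x \notin N -> exists L a, [/\ L \in Ls, x \in vset L & [/\ a \in vset L, a \in N,
    a \in vset Z & K a]])).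
suff: S v by case=> _ [+ _]; exact.
apply: (Zc S _ u v) => //; last by split=> //; split=> // /negP.
move=> a b abZ [aZ [aN aN']]; have [L LL abL] := link_cover sys (ZG _ abZ).
have aL : a \in vset L by apply: incident_in_vset abL _; rewrite set21.
have bL : b \in vset L by apply: incident_in_vset abL _; rewrite set22.
have bZ : b \in vset Z by apply: incident_in_vset abZ _; rewrite set22.
have [a' [a'L a'N a'Z Ka']] : exists a', [/\ a' \in vset L, a' \in N, a' \in vset Z & K a'].
  case: (boolP (a \in N)) => [/[dup] aN0 /aN Ka|/[dup] aN0 /aN']; first by exists a.
  case=> M [a' [ML aM [a'M a'N a'Z Ka']]]; exists a'; split=> //.
  suff -> : L = M by [].
  apply/eqP; apply: contraNT aN0 => LM.
  by apply: (subsetP (link_meet sys LL ML LM)); rewrite inE aL.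
split=> //; split=> [bN|bN]; first exact: (HK L a' b).
by exists L, a'.
Qed.

(** At an internal vertex of [L] all edges of [G] belong to [L]. If [C] passes there it has two
    edges and [L] has at most two, so these coincide; hence containing one edge of [L] propagates
    along [L]. *)
Lemma link_in_cycle C L e : is_cycle C -> subgraph C G -> L \in Ls ->
  e \in eset L -> e \in eset C -> eset L \subset eset C.
Proof.
move=> hC /andP[_ /subsetP CG] LL eL eC; apply/subsetP => f fL.
have [x [y [Lxy xy LN]]] := link_path sys LL.
apply: (path_edges_all (T := fun e => e \in eset C) Lxy _ eL fL eC) => {e f fL eL eC}.
move=> v e f vL vx vy eL fL ve vf eC.
have vN : v \notin N.
  apply: contra vx => vN; have : v \in vset L :&: N by rewrite inE vL.
  by rewrite LN !inE (negbTE vy) orbF.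
have vC := incident_in_vset eC ve.
suff E : [set e in eset C | v \in e] = [set e in eset L | v \in e].
  have : f \in [set e in eset L | v \in e] by rewrite inE fL.
  by rewrite -E inE => /andP[].
apply/eqP; rewrite eqEcard; apply/andP; split; last first.
  rewrite -/(degree L v) -/(degree C v) (cycle_degree hC vC).
  by apply: path_degree_le2; exists x, y.
apply/subsetP => g; rewrite !inE => /andP[gC vg]; rewrite vg andbT.
have [M ML gM] := link_cover sys (CG _ gC).
suff -> : L = M by [].
apply/eqP; apply: contraNT vN => LM; apply: (subsetP (link_meet sys LL ML LM)).
by rewrite inE vL (incident_in_vset gM vg).
Qed.

Lemma link_nonempty L : L \in Ls -> exists e, e \in eset L.
Proof.
move=> LL; have [x [y [[p [_ _ EE] <-] xy _]]] := link_path sys LL.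
case: p EE xy => [|z p] EE; first by rewrite eqxx.
by exists [set x; z]; rewrite EE !inE eqxx.
Qed.

Definition cycle_links C := [set L in Ls | eset L \subset eset C].

Lemma cycle_linksP C e : is_cycle C -> subgraph C G -> e \in eset C ->
  exists2 L, L \in cycle_links C & e \in eset L.
Proof.
move=> hC CG eC; have /andP[_ /subsetP CG'] := CG.
have [L LL eL] := link_cover sys (CG' _ eC); exists L => //.
by rewrite inE LL; exact: link_in_cycle eL eC.
Qed.

(** Each edge of [C] lies in exactly one link, and that link is entirely in [C]. The monoid is
    arbitrary because both degrees and group values are split this way. *)
Lemma big_cycle_links (R : Type) (idx : R) (op : Monoid.com_law idx)
    (f : {set V} -> R) C : is_cycle C -> subgraph C G ->
  \big[op/idx]_(e in eset C) f e =
  \big[op/idx]_(L in cycle_links C) \big[op/idx]_(e in eset L) f e.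
Proof.
move=> hC CG; rewrite (exchange_big_dep (fun e => e \in eset C)) /=; last first.
  by move=> L e; rewrite inE => /andP[_ /subsetP h] /h.
apply: eq_bigr => e eC; have [L LC eL] := cycle_linksP hC CG eC.
rewrite (big_pred1 L) // => M /=; apply/andP/eqP => [[MC eM]|->] //.
by move: LC MC; rewrite !inE => /andP[LL _] /andP[ML _]; exact: (link_edges sys) eL.
Qed.

Lemma link_degree L v : L \in Ls -> v \in N -> degree L v = (v \in vset L).
Proof.
move=> LL vN; have [x [y [Lxy xy LN]]] := link_path sys LL.
have Lyx := path_between_sym Lxy; have yx : y != x by rewrite eq_sym.
case: (boolP (v \in vset L)) => vL.
  have : v \in vset L :&: N by rewrite inE vL.
  by rewrite LN !inE => /orP[]/eqP->; rewrite ?(path_degree_end Lxy) ?(path_degree_end Lyx).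
apply: eq_card0 => e; rewrite !inE; apply/negP => /andP[eL ve].
by rewrite (incident_in_vset eL ve) in vL.
Qed.

(** A link through the branch vertex [v] contributes 1 to the degree of [v] in [C], which is 0 or
    2. *)
Lemma even_cycle_links C v : is_cycle C -> subgraph C G -> v \in N ->
  ~~ odd #|[set L in cycle_links C | v \in vset L]|.
Proof.
move=> hC CG vN; have H (P : sgraph V) : degree P v = \sum_(e in eset P) (v \in e).
  by rewrite /degree -sum1_card big_mkcond /= [RHS]big_mkcond /=; apply: eq_bigr => e _;
    rewrite inE; case: (e \in eset P) (v \in e) => [] [].
suff -> : #|[set L in cycle_links C | v \in vset L]| = degree C v.
  case: (boolP (v \in vset C)) => vC; first by rewrite (cycle_degree hC vC).
  rewrite /degree eq_card0 // => e; rewrite !inE; apply/negP => /andP[eL ve].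
  by rewrite (incident_in_vset eL ve) in vC.
rewrite H (big_cycle_links _ (fun e => (v \in e) : nat) hC CG) -sum1_card.
rewrite big_mkcond /= [RHS]big_mkcond /=; apply: eq_bigr => L _; rewrite inE.
by case: (boolP (L \in cycle_links C)) => //=; rewrite -H inE => /andP[LL _];
  rewrite link_degree //; case: (v \in _).
Qed.

Lemma cycle_links_vset C L : L \in cycle_links C -> vset L \subset vset C.
Proof.
rewrite inE => /andP[LL /subsetP LC].
have [x [y [Lxy xy _]]] := link_path sys LL.
apply/subsetP => v vL; suff : 0 < degree L v.
  rewrite card_gt0 => /set0Pn[e]; rewrite inE => /andP[/LC eC ve].
  exact: incident_in_vset eC ve.
case: (eqVneq v x) => [->|vx]; first by rewrite (path_degree_end Lxy).
case: (eqVneq v y) => [->|vy].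
  by rewrite (path_degree_end (path_between_sym Lxy)) // eq_sym.
by rewrite (path_degree_internal Lxy).
Qed.

End LinkSystems.

(** * The planar potential of the elementary wall *)

Lemma big_addb_set2 (T : finType) (s : pred T) (a b : T) : a != b ->
  \big[addb/false]_(v in [set a; b]) s v = s a (+) s b.
Proof. by move=> ab; rewrite big_setU1 ?inE // big_set1. Qed.

Section GraphBoundary.
Variables (V : finType) (G : sgraph V) (f : {set V} -> bool).

(** The boundary modulo 2 of the edge set [f]. Sums with [addb] serve throughout as sums over the
    field with two elements. *)
Definition odd_at (v : V) : bool :=
  \big[addb/false]_(e in eset G) (f e && (v \in e)).

(** Summation by parts: pairing [s] with the boundary of [f] counts the chosen edges along which [s]
    changes. *)
Lemma sum_odd_at (s : pred V) :
  \big[addb/false]_v (s v && odd_at v) =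
  \big[addb/false]_(e in eset G) (f e && \big[addb/false]_(v in e) s v).
Proof.
under eq_bigr do rewrite /odd_at big_distrr /=.
rewrite exchange_big /=; apply: eq_bigr => e _.
rewrite big_distrr /= [RHS]big_mkcond /=; apply: eq_bigr => v _.
by case: (v \in e) (s v) (f e) => [] [] [].
Qed.

End GraphBoundary.

Section ElementaryWall.
Variables (c r : nat).
Hypothesis c3 : 3 <= c.
Notation U := ('I_c.*2 * 'I_r)%type.
Notation H := (elementary_wall c r).
Implicit Types (u v a b : U) (e : {set U}).

Lemma brick_adj_edge a b : brick_adj a b -> [set a; b] \in eset (brick_graph c r).
Proof. by move=> ab; apply/imsetP; exists (a, b); rewrite ?inE. Qed.

Lemma brick_adjE a b : brick_adj a b =
  ((a.2 == b.2 :> nat) && (a.1.+1 == b.1 :> nat)) ||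
  [&& a.1 == b.1 :> nat, a.2.+1 == b.2 :> nat & odd (a.1 + a.2)].
Proof. by []. Qed.

Lemma brick_adj_neq a b : brick_adj a b -> a != b.
Proof. by rewrite brick_adjE => h; apply/eqP => E; move: h; rewrite E; lia. Qed.

Lemma cell_eq a b : a.1 = b.1 :> nat -> a.2 = b.2 :> nat -> a = b.
Proof. by case: a b => [a1 a2] [b1 b2] /= /val_inj-> /val_inj->. Qed.

Lemma wall_inner u : 0 < u.1 -> u.1.+1 < c.*2 -> u \in vset H.
Proof.
move=> u0 u1; rewrite /vset /= !inE andTb.
have lP : u.1.-1 < c.*2 by lia.
pose a : U := (Ordinal lP, u.2); pose b : U := (Ordinal u1, u.2).
have au : brick_adj a u by rewrite brick_adjE /= prednK ?eqxx.
have ub : brick_adj u b by rewrite brick_adjE /= !eqxx.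
have : [set [set a; u]; [set u; b]] \subset [set e in eset (brick_graph c r) | u \in e].
  apply/subsetP => e; move/set2P => []->; rewrite inE brick_adj_edge //.
    by rewrite set22.
  by rewrite set21.
move/subset_leq_card; rewrite cards2.
suff -> : [set a; u] != [set u; b] by rewrite /degree; case: #|_| => [|[]].
apply/eqP => /setP /(_ a); rewrite set21 => /esym/set2P[] E.
  by move: (brick_adj_neq au); rewrite E eqxx.
have : a.1 = b.1 :> nat by rewrite E.
by rewrite /=; lia.
Qed.

Lemma wall_edgeP e : e \in eset H ->
  exists a b, [/\ e = [set a; b], brick_adj a b, a \in vset H & b \in vset H].
Proof.
move=> eH; have [_ /subsetP es] := edgeP eH.
move: eH; rewrite inE => /andP[/imsetP[[a b] /= ab E] _]; subst e.
by rewrite inE in ab; exists a, b; split=> //; apply: es; rewrite ?set21 ?set22.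
Qed.

Lemma wall_edgeI a b : brick_adj a b -> a \in vset H -> b \in vset H ->
  [set a; b] \in eset H.
Proof.
move=> ab; rewrite /vset /= => /setIP[_ aH] /setIP[_ bH].
rewrite inE brick_adj_edge //=; apply/subsetP => v.
by move/set2P => []->.
Qed.

(* The ends of the rows: each row is a path in which the other vertices have
   two horizontal neighbours. *)
Definition row_end u : bool := (u \in vset H) &&
  ~~ [exists a, exists b, [&& a \in vset H, b \in vset H, a.2 == u.2, b.2 == u.2,
        a.1.+1 == u.1 :> nat & u.1.+1 == b.1 :> nat]].

(** Linearizes the column boundary: positions 0 to r-1 going up the left side, then r to 2r-1 going
    down the right side. *)
Definition bpos u : nat := if u.1 < c then u.2 : nat else r.*2.-1 - u.2.

Lemma row_end_wall u : row_end u -> u \in vset H.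
Proof. by case/andP. Qed.

Lemma row_endN u a b : row_end u -> a \in vset H -> b \in vset H ->
  a.2 = u.2 :> nat -> b.2 = u.2 :> nat -> a.1.+1 = u.1 -> u.1.+1 = b.1 -> False.
Proof.
move=> /andP[_ /existsPn /(_ a) /existsPn /(_ b)] /negP n aH bH a2 b2 a1 b1; apply: n.
by apply/and5P; split=> //; try apply/andP; try split; apply/eqP=> //; apply/val_inj.
Qed.

(** Deleting the two vertices of degree 1 can move a row end one step inwards, hence two admissible
    positions on either side. *)
Lemma row_end_outer u : row_end u -> u.1 <= 1 \/ c.*2 <= u.1 + 2.
Proof.
move=> uE; case: (leqP u.1 1) => [|u1]; first by left.
case: (leqP c.*2 (u.1 + 2)) => [|u2]; first by right.
have aP : u.1.-1 < c.*2 by lia. have bP : u.1.+1 < c.*2 by lia.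
case: (@row_endN u (Ordinal aP, u.2) (Ordinal bP, u.2)) => //=; try lia;
  by apply: wall_inner => /=; lia.
Qed.

Lemma row_end_left u v : row_end u -> v \in vset H -> u.2 = v.2 :> nat ->
  u.1 <= 1 -> v.1 < u.1 -> False.
Proof.
move=> uE vH uv u1 vu; have bP : u.1.+1 < c.*2 by lia.
case: (@row_endN u v (Ordinal bP, u.2)) => //=; try lia.
by apply: wall_inner => /=; lia.
Qed.

Lemma row_end_right u v : row_end u -> v \in vset H -> u.2 = v.2 :> nat ->
  c.*2 <= u.1 + 2 -> u.1 < v.1 -> False.
Proof.
move=> uE vH uv u1 vu; have v1 := ltn_ord v.1; have aP : u.1.-1 < c.*2 by lia.
case: (@row_endN u (Ordinal aP, u.2) v) => //=; try lia.
by apply: wall_inner => /=; lia.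
Qed.

Lemma bpos_inj u v : row_end u -> row_end v -> bpos u = bpos v -> u = v.
Proof.
move=> uE vE; rewrite /bpos; have u2 := ltn_ord u.2; have v2 := ltn_ord v.2.
have uH := row_end_wall uE; have vH := row_end_wall vE.
have := row_end_outer uE; have := row_end_outer vE => ov ou E.
have uv2 : u.2 = v.2 :> nat by move: E; case: (ltnP u.1 c); case: (ltnP v.1 c); lia.
case: (ltngtP u.1 v.1) => [uv|uv|uv]; last exact: cell_eq.
  case: ou => [u1|u1]; last by case: (row_end_right uE vH).
  case: ov => [v1|v1]; first by case: (row_end_left vE uH).
  by move: E; rewrite /bpos; case: (ltnP u.1 c); case: (ltnP v.1 c); lia.
case: ou => [u1|u1]; first by case: (row_end_left uE vH).
case: ov => [v1|v1]; last by case: (row_end_right vE uH).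
by move: E; rewrite /bpos; case: (ltnP u.1 c); case: (ltnP v.1 c); lia.
Qed.

Section Potential.
Variable f : {set U} -> bool.
Notation odd_at := (odd_at H f).
Hypothesis odd_row_end : forall v, odd_at v -> row_end v.

Definition untouched u : Prop := forall e, e \in eset H -> u \in e -> f e = false.

Let cut u e := (\big[addb/false]_(v in e) (v.2 <= u.2)) && [forall v in e, v.1 < u.1].
Let left_below u v := (v.1 < c) && (v.2 <= u.2).

(* Ray casting: count the chosen vertical edges that leave the row of [u]
   upwards to the left of [u]; the second term corrects for the ends of the
   chosen paths on the left side. *)
Definition potential u : bool :=
  \big[addb/false]_(e in eset H) (f e && cut u e) (+)
  \big[addb/false]_v (left_below u v && odd_at v).

Lemma untouched_even u : untouched u -> odd_at u = false.
Proof.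
move=> uf; apply: big1 => e eH; case: (boolP (u \in e)) => ue; rewrite ?andbF //.
by rewrite uf.
Qed.

Let cutE u a b : a != b -> cut u [set a; b] =
  ((a.2 <= u.2) (+) (b.2 <= u.2)) && (a.1 < u.1) && (b.1 < u.1).
Proof.
move=> ab; rewrite /cut big_addb_set2 // -andbA; congr (_ && _).
apply/forall_inP/andP => [h|[h1 h2] v /set2P[]-> //].
by split; apply: h; rewrite ?set21 ?set22.
Qed.

Lemma eq_edge_sum (s t : {set U} -> bool) :
  (forall a b, [set a; b] \in eset H -> f [set a; b] -> brick_adj a b ->
     a \in vset H -> b \in vset H -> s [set a; b] = t [set a; b]) ->
  \big[addb/false]_(e in eset H) (f e && s e) =
  \big[addb/false]_(e in eset H) (f e && t e).
Proof.
move=> st; apply: eq_bigr => e eH; case: (boolP (f e)) => //= fe.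
by have [a [b [E ab aH bH]]] := wall_edgeP eH; subst e; apply: st.
Qed.

Lemma eq_odd_sum (s t : pred U) : (forall v, odd_at v -> s v = t v) ->
  \big[addb/false]_v (s v && odd_at v) = \big[addb/false]_v (t v && odd_at v).
Proof.
by move=> st; apply: eq_bigr => v _; case: (boolP (odd_at v)) => [/st->|_]; rewrite ?andbF.
Qed.

Lemma untouchedN u a b : untouched u -> [set a; b] \in eset H -> f [set a; b] ->
  ~ (a.1 = u.1 :> nat /\ a.2 = u.2 :> nat) /\ ~ (b.1 = u.1 :> nat /\ b.2 = u.2 :> nat).
Proof.
move=> uf eH fe; split=> -[h1 h2]; move: (uf _ eH);
  by rewrite fe -(cell_eq h1 h2) !inE eqxx ?orbT => /(_ isT).
Qed.

(** The only vertical edges met by the ray of [b] and not by that of [a] are incident with [a], and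
    none of these is chosen. *)
Lemma potential_horizontal a b : a.2 = b.2 :> nat -> a.1.+1 = b.1 :> nat ->
  untouched a -> potential a = potential b.
Proof.
move=> ab2 ab1 af; rewrite /potential /left_below ab2; congr (_ (+) _).
apply: eq_edge_sum => x y xyH fxy adj xH yH.
rewrite !cutE ?(brick_adj_neq adj) // ab2.
have [n1 n2] := untouchedN af xyH fxy.
by move: adj; rewrite brick_adjE; lia.
Qed.

Lemma addb_eq x y z t : (x (+) y = z (+) t) -> (x (+) z = y (+) t).
Proof. by case: x y z t => [] [] [] []. Qed.

Lemma odd_left u v : u \in vset H -> untouched u -> odd_at v -> v.2 = u.2 :> nat ->
  (v.1 < c) = (v.1 < u.1).
Proof.
move=> uH uf vo vu; have vE := odd_row_end vo.
have vu1 : v.1 != u.1 :> nat.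
  apply: contraTneq vo => vu1; by rewrite (cell_eq vu1 vu) untouched_even.
case: (row_end_outer vE) => v1.
  have -> : v.1 < c by lia.
  by case: ltngtP vu1 => // uv; case: (row_end_left vE uH).
have -> : (v.1 < c) = false by lia.
by case: ltngtP vu1 => // uv; case: (row_end_right vE uH).
Qed.

(** The two rays enclose the part of the upper row to the left of [b]. As [b] is untouched, the
    chosen edges leaving this part are the vertical ones counted by exactly one ray; by [odd_left]
    the odd vertices in it are the left ends in which the correction terms differ. *)
Lemma potential_vertical a b : a.1 = b.1 :> nat -> a.2.+1 = b.2 :> nat ->
  b \in vset H -> untouched b -> potential a = potential b.
Proof.
move=> ab1 ab2 bH bf; rewrite /potential; apply: addb_eq.
rewrite -!big_split /=.
transitivity (\big[addb/false]_(v : U) (((v.1 < b.1) && (v.2 == b.2)) && odd_at v)).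
  rewrite sum_odd_at; under eq_bigr do rewrite -andb_addr.
  apply: eq_edge_sum => x y xyH fxy adj xH yH.
  rewrite !cutE ?(brick_adj_neq adj) // big_addb_set2 ?(brick_adj_neq adj) //.
  have [n1 n2] := untouchedN bf xyH fxy.
  rewrite -!(inj_eq val_inj) /=; move: adj; rewrite brick_adjE.
  by lia.
under [RHS]eq_bigr do rewrite -andb_addl.
apply: eq_odd_sum => v vo; rewrite /left_below -(inj_eq val_inj) /=.
case: (eqVneq (v.2 : nat) b.2) => [vb|vb]; last by lia.
by rewrite andbT -(odd_left bH bf vo vb); lia.
Qed.

Lemma potential_edge a b : [set a; b] \in eset H -> untouched a -> untouched b ->
  potential a = potential b.
Proof.
move=> eH af bf; have [x [y [E adj xH yH]]] := wall_edgeP eH.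
have P : untouched x -> untouched y -> potential x = potential y.
  move=> xf yf; move: adj; rewrite brick_adjE => /orP[/andP[/eqP h1 /eqP h2]|/and3P[/eqP h1 /eqP h2 _]].
    exact: potential_horizontal.
  exact: potential_vertical.
have ab : a != b.
  by apply/eqP=> ab; have [] := edgeP eH; rewrite ab setUid cards1.
have /set2P aE : a \in [set x; y] by rewrite -E set21.
have /set2P bE : b \in [set x; y] by rewrite -E set22.
case: aE bE => [aE|aE] [bE|bE]; subst; rewrite ?eqxx // in ab *; first exact: P.
by rewrite P.
Qed.

(** At a left end the ray is empty and only the correction counts. At a right end it sweeps a
    complete row and counts the boundary of everything at height at most [u.2]; with the correction,
    the odd right ends from [u] on remain. *)
Lemma potential_row_end u : row_end u -> untouched u ->
  potential u = \big[addb/false]_v ((bpos v < bpos u) && odd_at v).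
Proof.
move=> uE uf; have uH := row_end_wall uE; rewrite /potential.
case: (row_end_outer uE) => u1.
  rewrite big1 ?addFb => [|e eH].
    apply: eq_odd_sum => v vo; have vE := odd_row_end vo.
    have u2 := ltn_ord u.2; have v2 := ltn_ord v.2.
    rewrite /left_below /bpos; have -> : u.1 < c by lia.
    case: (ltnP v.1 c) => v1; last by lia.
    case: (eqVneq (v.2 : nat) u.2) => [vu|]; last by lia.
    have := odd_left uH uf vo vu; rewrite v1 => /esym vu1.
    by case: (row_end_left uE (row_end_wall vE)).
  have [x [y [-> adj xH yH]]] := wall_edgeP eH.
  rewrite cutE ?(brick_adj_neq adj) //; apply/negP => /andP[fe h].
  move: adj; rewrite brick_adjE => adj.
  have [xu|xu|] := ltngtP x.2 u.2; [lia|lia|move=> xu].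
  by apply: (row_end_left uE xH) => //; lia.
have -> : \big[addb/false]_(e in eset H) (f e && cut u e) =
          \big[addb/false]_(v : U) ((v.2 <= u.2) && odd_at v).
  rewrite sum_odd_at; apply: eq_edge_sum => x y xyH fxy adj xH yH.
  rewrite cutE ?big_addb_set2 ?(brick_adj_neq adj) //.
  have [n1 n2] := untouchedN uf xyH fxy.
  have x1 := ltn_ord x.1; have y1 := ltn_ord y.1.
  move: adj; rewrite brick_adjE => adj.
  have [xu|xu|xu] := ltngtP x.2 u.2.
  - by move: adj xu n1 n2; lia.
  - by move: adj xu n1 n2; lia.
  case: (ltnP u.1 x.1) => ux; first by case: (row_end_right uE xH).
  by lia.
(* The boundary has even total, which turns the ends from position [bpos u] on into those before
   it. *)
have T0 : \big[addb/false]_(v : U) (true && odd_at v) = false.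
  rewrite (sum_odd_at H f predT) big1 // => e eH.
  have [x [y [-> adj xH yH]]] := wall_edgeP eH.
  by rewrite big_addb_set2 ?(brick_adj_neq adj) // andbF.
rewrite -[RHS]addbF -[X in _ = _ (+) X]T0 -!big_split /=.
under eq_bigr do rewrite -andb_addl.
under [RHS]eq_bigr do rewrite -[X in _ (+) X]andTb -andb_addl.
apply: eq_odd_sum => v vo; have vE := odd_row_end vo; rewrite /left_below /bpos.
have u2 := ltn_ord u.2; have v2 := ltn_ord v.2.
have -> : (u.1 < c) = false by lia.
by case: (ltnP v.1 c) => v1 /=; lia.
Qed.

End Potential.

End ElementaryWall.

(** * Subdivided walls and their boundary *)

Section GraphUnion.
Variable V : finType.
Implicit Types (G H : sgraph V).

Lemma in_vset_union G H x :
  (x \in vset (graph_union G H)) = (x \in vset G) || (x \in vset H).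
Proof.
apply/bigcupP/orP => [[K /set2P[]-> h]|[]]; [by left|by right|by exists G; rewrite ?set21|].
by exists H; rewrite ?set22.
Qed.

Lemma in_eset_union G H x :
  (x \in eset (graph_union G H)) = (x \in eset G) || (x \in eset H).
Proof.
apply/bigcupP/orP => [[K /set2P[]-> h]|[]]; [by left|by right|by exists G; rewrite ?set21|].
by exists H; rewrite ?set22.
Qed.

Lemma degree_sub G H x : eset G \subset eset H -> degree G x <= degree H x.
Proof.
move=> /subsetP GH; apply: subset_leq_card; apply/subsetP => e.
by rewrite !inE => /andP[/GH-> ->].
Qed.

End GraphUnion.

Section WallGraph.
Variables (V : finType) (W : wall V).
Notation c := (wcols W).
Notation r := (wrows W).
Notation U := ('I_c.*2 * 'I_r)%type.
Notation H := (elementary_wall c r).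
Notation S := (wsub W).
Notation sd := (sd_vertex (wsub W)).
Notation c3 := (wcols_ge3 W).
Implicit Types (u v w a b : U) (X : sgraph V).

Lemma in_vset_image (K : sgraph U) x : x \in vset (sd_image S K) ->
  (exists2 u, u \in vset K & x = sd u) \/
  (exists2 e, e \in eset K & x \in vset (sd_path S e)).
Proof.
rewrite in_vset_union => /orP[/imsetP[u uK ->]|]; first by left; exists u.
by move/bigcupP=> [_ /imsetP[e eK ->] xe]; right; exists e.
Qed.

Lemma vset_image_path (K : sgraph U) e x : e \in eset K ->
  x \in vset (sd_path S e) -> x \in vset (sd_image S K).
Proof.
move=> eK xe; rewrite in_vset_union; apply/orP; right.
by apply/bigcupP; exists (sd_path S e) => //; apply/imsetP; exists e.
Qed.

Lemma vset_image_nail (K : sgraph U) u : u \in vset K -> sd u \in vset (sd_image S K).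
Proof. by move=> uK; rewrite in_vset_union; apply/orP; left; apply/imsetP; exists u. Qed.

Lemma eset_imageP (K : sgraph U) f : reflect
  (exists2 e, e \in eset K & f \in eset (sd_path S e)) (f \in eset (sd_image S K)).
Proof.
rewrite in_eset_union [f \in eset (edgeless _)]inE /=.
apply: (iffP bigcupP) => [[_ /imsetP[e eK ->] fe]|[e eK fe]]; first by exists e.
by exists (sd_path S e) => //; apply/imsetP; exists e.
Qed.

Lemma nail_wall u : u \in vset H -> sd u \in nails W.
Proof. by move=> uH; apply/imsetP; exists u. Qed.

Lemma nailP x : x \in nails W -> exists2 u, u \in vset H & x = sd u.
Proof. by case/imsetP=> u uH ->; exists u. Qed.

Lemma nails_wall : nails W \subset vset (wgraph W).
Proof. by apply/subsetP => x /nailP[u uH ->]; exact: vset_image_nail. Qed.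

Lemma sd_inj u v : u \in vset H -> v \in vset H -> sd u = sd v -> u = v.
Proof. exact: (@sd_vertex_inj _ _ _ S). Qed.

Lemma wall_edge_sub e u : e \in eset H -> u \in e -> u \in vset H.
Proof. exact: incident_in_vset. Qed.

Lemma mem_sd_path e u : e \in eset H -> u \in vset H ->
  (sd u \in vset (sd_path S e)) = (u \in e).
Proof.
move=> eH uH; have E := sd_path_branch S eH.
have -> : (sd u \in vset (sd_path S e)) = (sd u \in sd @: e).
  by rewrite -E inE [X in _ && X](_ : _ = true) ?andbT //; exact: nail_wall.
apply/imsetP/idP => [[v ve uv]|ue]; last by exists u.
by rewrite (sd_inj uH (wall_edge_sub eH ve) uv).
Qed.

Lemma sd_path_inj e f : e \in eset H -> f \in eset H -> sd_path S e = sd_path S f -> e = f.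
Proof.
move=> eH fH E; apply/setP => u; apply/idP/idP => ue.
  by rewrite -(mem_sd_path fH) ?(wall_edge_sub eH ue) // -E mem_sd_path ?(wall_edge_sub eH ue).
by rewrite -(mem_sd_path eH) ?(wall_edge_sub fH ue) // E mem_sd_path ?(wall_edge_sub fH ue).
Qed.

Lemma sd_path_link a b : [set a; b] \in eset H ->
  [/\ path_between (sd_path S [set a; b]) (sd a) (sd b), sd a != sd b
    & vset (sd_path S [set a; b]) :&: nails W = [set sd a; sd b]].
Proof.
move=> eH; have [h _] := edgeP eH; split; first exact: (sd_pathP S eH).
  apply/eqP => /sd_inj E; move: h; rewrite E ?setUid ?cards1 //;
    by apply: (wall_edge_sub eH); rewrite ?set21 ?set22.
by rewrite (sd_path_branch S eH) imsetU1 imset_set1.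
Qed.

Lemma wall_edge_pair e : e \in eset H -> exists a b, [/\ e = [set a; b], a \in vset H & b \in vset H].
Proof. by case/wall_edgeP => a [b [-> _ aH bH]]; exists a, b. Qed.

Lemma wall_links :
  link_system (wgraph W) [set sd_path S e | e in eset H] (nails W).
Proof.
split.
- move=> _ /imsetP[e eH ->]; have [a [b [E aH bH]]] := wall_edge_pair eH; subst e.
  by have [h1 h2 h3] := sd_path_link eH; exists (sd a), (sd b).
- move=> _ _ /imsetP[e eH ->] /imsetP[f fH ->] ef.
  by apply: sd_path_disjoint => //; apply: contraNneq ef => ->.
- move=> _ _ g /imsetP[e eH ->] /imsetP[f fH ->] ge gf.
  case: (eqVneq e f) => [->//|ef]; exfalso.
  (* A common edge of two subdivision paths would join two nails, and these determine the edge of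
     the elementary wall. *)
  have gN x : x \in g -> x \in nails W.
    move=> xg; apply: (subsetP (sd_path_disjoint S eH fH ef)).
    by rewrite inE !(incident_in_vset _ xg).
  have [x [y [xy gE]]] := edge_pair ge.
  have xg : x \in g by rewrite gE set21.
  have yg : y \in g by rewrite gE set22.
  have [u uH xu] := nailP (gN _ xg); have [v vH yv] := nailP (gN _ yg).
  have uv : u != v by apply: contraNneq xy => uv; rewrite xu yv uv.
  have ue : u \in e by rewrite -mem_sd_path // -xu (incident_in_vset ge).
  have ve : v \in e by rewrite -mem_sd_path // -yv (incident_in_vset ge).
  have uf : u \in f by rewrite -mem_sd_path // -xu (incident_in_vset gf).
  have vf : v \in f by rewrite -mem_sd_path // -yv (incident_in_vset gf).
  have E2 (d : {set U}) : d \in eset H -> u \in d -> v \in d -> [set u; v] = d.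
    move=> /edgeP[d2 _] ud vd; apply/eqP; rewrite eqEcard d2 cards2 uv andbT.
    by apply/subsetP => z /set2P[]->.
  by move: ef; rewrite -(E2 e) // -(E2 f) // eqxx.
- by move=> g /eset_imageP[e eH ge]; exists (sd_path S e) => //; apply/imsetP; exists e.
Qed.

Lemma nail_induced (A : {set U}) u : u \in vset H ->
  (sd u \in vset (sd_image S (induced H A))) = (u \in A).
Proof.
move=> uH; apply/idP/idP => [/in_vset_image[[v]|[e]]|uA]; last first.
- by apply: vset_image_nail; rewrite /vset inE; apply/andP.
- rewrite /eset inE => /andP[eH /subsetP eA]; rewrite mem_sd_path //; exact: eA.
- by rewrite /vset inE => /andP[vH vA] /sd_inj ->.
Qed.

(** Ends are located by degree: a subdividing vertex has degree at least 2 in its row, and so has a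
    nail with two horizontal neighbours, since distinct subdivision paths share no edge. *)
Lemma column_boundary_row_end x : x \in column_boundary W ->
  exists2 u, row_end u & x = sd u.
Proof.
case/bigcupP => j _; rewrite inE => /asboolP[y Rxy].
have dx := path_degree_end_le1 Rxy; have [xR _] := path_between_mem Rxy.
set K := elementary_row c r j in Rxy dx xR.
have KH e : e \in eset K -> e \in eset H by rewrite inE => /andP[].
have KR e : e \in eset K -> eset (sd_path S e) \subset eset (wrow W j).
  by move=> eK; apply/subsetP => f fe; apply/eset_imageP; exists e.
have [u uK xu] : exists2 u, u \in vset K & x = sd u.
  case/in_vset_image: xR => // -[e eK xe]; have eH := KH _ eK.
  have [a [b [E aH bH]]] := wall_edge_pair eH; subst e.
  have [h1 _ h2] := sd_path_link eH.
  case: (boolP (x \in nails W)) => [/nailP[u uH xu]|xN].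
    exists u => //; move: xe; rewrite xu mem_sd_path //.
    exact: incident_in_vset.
  have xab z : z \in vset H -> x != sd z by move=> zH; apply: contraNneq xN => ->; exact: nail_wall.
  have := degree_sub x (KR _ eK).
  by rewrite (path_degree_internal h1) ?xab // => /leq_trans/(_ dx).
exists u => //; have [uH uj] : u \in vset H /\ u.2 = j :> nat.
  by move: uK; rewrite /vset /= !inE => /andP[h /eqP].
rewrite /row_end uH; apply/negP => /existsP[a /existsP[b]].
move=> /and5P[aH bH /eqP a2 /eqP b2 /andP[/eqP a1 /eqP b1]].
have auH : [set a; u] \in eset H by apply: wall_edgeI => //; rewrite brick_adjE a2 a1 !eqxx.
have ubH : [set u; b] \in eset H by apply: wall_edgeI => //; rewrite brick_adjE b2 b1 !eqxx.
have auK : [set a; u] \in eset K.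
  by rewrite inE; apply/andP; split=> //; apply/subsetP=> z /set2P[]->; rewrite inE ?a2 uj.
have ubK : [set u; b] \in eset K.
  by rewrite inE; apply/andP; split=> //; apply/subsetP=> z /set2P[]->; rewrite inE ?b2 uj.
have deg1 e : e \in eset H -> u \in e -> exists2 f, f \in eset (sd_path S e) & x \in f.
  move=> eH ue; have := @link_degree _ _ _ _ wall_links (sd_path S e) x.
  rewrite xu mem_sd_path // ue => /(_ _ (nail_wall uH)) E.
  have : 0 < degree (sd_path S e) (sd u) by rewrite E //; apply/imsetP; exists e.
  by rewrite card_gt0 => /set0Pn[f]; rewrite inE => /andP[fe xf]; exists f.
have [f fe xf] := deg1 _ auH (set22 _ _); have [g ge xg] := deg1 _ ubH (set21 _ _).
have fg : f != g.
  apply/eqP => E; rewrite -E in ge.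
  have /sd_path_inj E2 : sd_path S [set a; u] = sd_path S [set u; b].
    by apply: (link_edges wall_links) fe ge; apply/imsetP; [exists [set a; u]|exists [set u; b]].
  have : a \in [set u; b] by rewrite -E2 ?set21.
  have ub1 : u.1 < b.1 by rewrite -b1.
  case/set2P=> E3; rewrite E3 in a1; first by move: (leqnn u.1); rewrite -{1}a1 ltnn.
  by move: ub1; rewrite -a1 ltnNge leqnSn.
suff : 1 < degree (wrow W j) x by move=> /leq_trans/(_ dx).
have <- : #|[set f; g]| = 2 by rewrite cards2 fg.
apply: subset_leq_card; apply/subsetP => h /set2P[]->; rewrite inE ?xf ?xg andbT.
  exact: (subsetP (KR _ auK)).
exact: (subsetP (KR _ ubK)).
Qed.

Lemma wall_ltE u v : row_end u -> row_end v -> sd u \in column_boundary W ->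
  sd v \in column_boundary W -> wall_lt W (sd u) (sd v) = (bpos u < bpos v).
Proof.
move=> uE vE uB vB; rewrite /wall_lt uB vB /=.
have uH := row_end_wall uE; have vH := row_end_wall vE.
have := row_end_outer c3 uE; have := row_end_outer c3 vE.
have := c3; have := ltn_ord u.1; have := ltn_ord v.1; have := ltn_ord u.2; have := ltn_ord v.2.
move=> v2 u2 v1 u1 cc ov ou.
rewrite /first_col /last_col /wcol !nail_induced // !inE.
have rowE z j : z \in vset H -> (sd z \in vset (wrow W j)) = (z.2 == j :> nat).
  by move=> zH; rewrite nail_induced // inE.
transitivity [|| (u.1./2 == 0) && (v.1./2 == c.-1), [&& u.1./2 == 0, v.1./2 == 0 & u.2 < v.2]
    | [&& u.1./2 == c.-1, v.1./2 == c.-1 & v.2 < u.2]].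
  apply/existsP/idP => [[j /existsP[k /and3P[]]]|h].
    by rewrite !rowE // => /eqP<- /eqP<-.
  by exists u.2; apply/existsP; exists v.2; rewrite !rowE // !eqxx.
by rewrite /bpos; case: (ltnP u.1 c) => ?; case: (ltnP v.1 c) => ?; lia.
Qed.

(** * Paths inside the first and last column *)

Section BoundaryPath.
Variable X : sgraph V.
Hypothesis bX : boundary_path W X.

Lemma boundary_path_wall : subgraph X (wgraph W).
Proof.
case: bX => _ /andP[/subsetP Xv /subsetP Xe]; apply/andP; split; apply/subsetP => x.
  move/Xv; rewrite in_vset_union => /orP[]/in_vset_image[[u uK ->]|[e eK xe]];
    try (by apply: vset_image_nail; move: uK; rewrite /vset inE => /andP[]);
    by apply: vset_image_path xe; move: eK; rewrite /eset inE => /andP[].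
move/Xe; rewrite in_eset_union => /orP[]/eset_imageP[e eK xe]; apply/eset_imageP;
  by exists e => //; move: eK; rewrite /eset inE => /andP[].
Qed.

Lemma boundary_path_column u : u \in vset H -> sd u \in vset X ->
  u.1 <= 1 \/ c.*2 <= u.1 + 2.
Proof.
move=> uH; case: bX => _ /andP[/subsetP Xv _] /Xv.
rewrite in_vset_union !nail_induced // !inE; have := c3; have := ltn_ord u.1.
by lia.
Qed.

(** Consecutive nails on [X] are adjacent in the elementary wall, so a property of cells can be
    followed along [X]. *)
Lemma boundary_path_closed (K : pred U) u v : row_end u -> row_end v ->
  sd u \in vset X -> sd v \in vset X ->
  (forall a b, a \in vset H -> b \in vset H -> sd a \in vset X -> sd b \in vset X ->
    brick_adj a b -> K a = K b) -> K u -> K v.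
Proof.
move=> uE vE uX vX HK Ku; have uH := row_end_wall uE; have vH := row_end_wall vE.
pose K' x := exists2 a, a \in vset H & x = sd a /\ K a.
suff : K' (sd v) by case=> a aH [/sd_inj -> //].
apply: (connected_links wall_links (path_connected (proj1 bX)) boundary_path_wall
   (K := K') _ (nail_wall uH) (nail_wall vH) uX vX); last by exists u.
move=> _ x y /imsetP[e eH ->] xe ye /nailP[a aH xa] /nailP[b bH yb] xX yX.
subst x y; case=> a' a'H [/sd_inj <- // Ka]; exists b => //; split=> //.
rewrite !mem_sd_path // in xe ye.
have [p [q [E pq pH qH]]] := wall_edgeP eH; subst e.
case/set2P: xe => xe; case/set2P: ye => ye; subst => //.
  by rewrite -(HK p q).
by rewrite (HK p q).
Qed.

(** With at least three columns, no wall edge joins the first column to the last. *)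
Lemma boundary_path_one_side u v : row_end u -> row_end v -> sd u \in vset X ->
  sd v \in vset X -> u.1 < c -> v.1 < c.
Proof.
move=> uE vE uX vX; apply: (@boundary_path_closed (fun a : U => a.1 < c) u v) => //.
move=> a b aH bH aX bX'; rewrite brick_adjE.
have := boundary_path_column aH aX; have := boundary_path_column bH bX'.
by have := c3; lia.
Qed.

(* In a column, consecutive vertices differ by one in [j.*2 + odd (i + j)]. *)
Lemma boundary_path_between u v w : row_end u -> row_end v -> row_end w ->
  sd u \in vset X -> sd v \in vset X -> (u.1 < c) = (v.1 < c) ->
  (u.1 < c) = (w.1 < c) -> u.2 < w.2 -> w.2 < v.2 -> sd w \in vset X.
Proof.
move=> uE vE wE uX vX uv uw uw2 wv2; apply: contraT => wX; exfalso.
pose K := fun a : U => ((a.1 < c) == (w.1 < c)) &&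
  (a.2.*2 + odd (a.1 + a.2) < w.2.*2 + odd (w.1 + w.2)).
suff : K v by rewrite /K; lia.
apply: (@boundary_path_closed K u v) => //; last by rewrite /K uw eqxx /=; lia.
move=> a b aH bH aX bX'; rewrite brick_adjE /K.
have aw : ~ (a.1 = w.1 :> nat /\ a.2 = w.2 :> nat).
  by case=> h1 h2; move: wX; rewrite -(cell_eq h1 h2) aX.
have bw : ~ (b.1 = w.1 :> nat /\ b.2 = w.2 :> nat).
  by case=> h1 h2; move: wX; rewrite -(cell_eq h1 h2) bX'.
have oa := boundary_path_column aH aX; have ob := boundary_path_column bH bX'.
have ow := row_end_outer c3 wE; have cc := c3.
have a1 := ltn_ord a.1; have b1 := ltn_ord b.1; have w1 := ltn_ord w.1.
case/orP => [/andP[/eqP ab2 /eqP ab1]|/and3P[/eqP ab1 /eqP ab2 oab]].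
  have -> : (a.1 < c) = (b.1 < c) by clear - oa ob cc a1 b1 ab1; lia.
  case: (eqVneq (b.1 < c) (w.1 < c)) => //= bwc.
  have wb2 : w.2 != b.2 :> nat.
    apply/eqP => wb2; case: (eqVneq (b.1 : nat) w.1) => [e|n]; first exact: bw.
    by apply: aw; split; [clear - oa ob ow cc a1 b1 w1 ab1 n bwc; lia|lia].
  move: (odd _) (odd _) (odd _) => p q s.
  by rewrite ab2; clear - wb2; case: p q s => [] [] [] /=; lia.
have -> : odd (b.1 + b.2) = false by rewrite -ab1 -ab2 addnS /= oab.
rewrite oab -ab1; case: (eqVneq (a.1 < c) (w.1 < c)) => //= bwc.
case: (eqVneq (w.2 : nat) b.2) => [wb2|wb2]; last first.
  by move: (odd _) => p; clear - wb2 ab2; case: p => /=; lia.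
suff -> : odd (w.1 + w.2) by clear - wb2 ab2; lia.
have : a.1.+1 = w.1 \/ w.1.+1 = a.1.
  have : w.1 <> a.1 :> nat by move=> e; apply: bw; rewrite -ab1.
  by clear - oa ow cc a1 w1 bwc; lia.
by case=> e; rewrite wb2 -ab2 ?addnS -?e ?addSn /= ?negbK // -[odd _]negbK -oddS -addSn e oab.
Qed.

(** [X] lies on one side, where [bpos] is monotone in the height: increasing on the left and
    decreasing on the right, whence the exchange of [u] and [v]. *)
Lemma boundary_path_convex u v w : row_end u -> row_end v -> row_end w ->
  sd u \in vset X -> sd v \in vset X -> bpos u < bpos w -> bpos w < bpos v ->
  sd w \in vset X.
Proof.
move=> uE vE wE uX vX.
have uv := boundary_path_one_side uE vE uX vX.
have vu := boundary_path_one_side vE uE vX uX.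
have := ltn_ord u.2; have := ltn_ord v.2; have := ltn_ord w.2.
rewrite /bpos; case: (ltnP u.1 c) => u1.
  rewrite uv //; case: (ltnP w.1 c) => w1; last by lia.
  move=> *; apply: (boundary_path_between uE vE wE) => //; lia.
have v1 : (v.1 < c) = false by apply/negP => /vu; lia.
rewrite v1.
case: (ltnP w.1 c) => w1 *; first by lia.
apply: (boundary_path_between vE uE wE) => //; lia.
Qed.

End BoundaryPath.

End WallGraph.

(** * Handles *)

Lemma pair_eq (T : finType) (a b x y : T) : a != b -> [set a; b] = [set x; y] ->
  (x = a /\ y = b) \/ (x = b /\ y = a).
Proof.
move=> ab E; have xy : x != y.
  by apply: contraNneq ab => xy; have := cards2 a b; rewrite E xy setUid cards1; case: eqP => // ->.
have /set2P[] : x \in [set a; b] by rewrite E set21.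
  move=> xa; have /set2P[] : y \in [set a; b] by rewrite E set22.
    by move=> ya; rewrite xa ya eqxx in xy.
  by left.
move=> xb; have /set2P[] : y \in [set a; b] by rewrite E set22.
  by right.
by move=> yb; rewrite xb yb eqxx in xy.
Qed.

Section Handles.
Variables (V : finType) (W : wall V).
Notation c := (wcols W).
Notation r := (wrows W).
Notation U := ('I_c.*2 * 'I_r)%type.
Notation H := (elementary_wall c r).
Notation sd := (sd_vertex (wsub W)).
Notation c3 := (wcols_ge3 W).
Implicit Types (u v w a b : U) (X P Q : sgraph V).

(** Orients a handle by [bpos] and names its ends by cells of the elementary wall, where the
    potential lives. *)
Record handle_from P u v : Prop := HandleFrom {
  handle_u : row_end u;
  handle_v : row_end v;
  handle_lt : bpos u < bpos v;
  handle_path : path_between P (sd u) (sd v);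
  handle_ub : sd u \in column_boundary W;
  handle_vb : sd v \in column_boundary W;
  handle_meet : vset P :&: vset (wgraph W) = [set sd u; sd v]
}.

Lemma handle_ends P : handle W P -> exists u v, handle_from P u v.
Proof.
case=> -[[x [y [Pxy xW yW PW]]] P0] PB.
have [xP yP] := path_between_mem Pxy.
have xy : x != y.
  apply: contraNneq P0 => xy; case: Pxy => p [Up _ ->]; rewrite -xy => lx.
  have -> : p = [::]; last by rewrite set_nil.
  by case: p Up lx => // z p /andP[/negP n _] /= lx; case: n; rewrite -{1}lx mem_last.
have E := endvertices_path Pxy.
have xB : x \in column_boundary W by apply: (subsetP PB); rewrite E set21.
have yB : y \in column_boundary W by apply: (subsetP PB); rewrite E set22.
have [u uE xu] := column_boundary_row_end xB.
have [v vE yv] := column_boundary_row_end yB.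
have M : vset P :&: vset (wgraph W) = [set x; y].
  apply/setP => z; rewrite !inE; apply/andP/orP => [[zP zW]|[]/eqP-> //].
  case: (eqVneq z x) => [|zx]; [by left|case: (eqVneq z y) => [|zy]; [by right|]].
  by have := PW _ zP zx zy; rewrite setUid zW.
have uv : bpos u != bpos v.
  by apply: contraNneq xy => /(bpos_inj c3 uE vE) uv; rewrite xu yv uv.
subst x y; case: (ltngtP (bpos u) (bpos v)) uv => // h _; [exists u, v|exists v, u]; split=> //.
  exact: path_between_sym.
by rewrite M setUC.
Qed.

Section HandleFacts.
Variables (P : sgraph V) (u v : U).
Hypothesis Puv : handle_from P u v.

Lemma handle_uH : u \in vset H. Proof. exact: row_end_wall (handle_u Puv). Qed.
Lemma handle_vH : v \in vset H. Proof. exact: row_end_wall (handle_v Puv). Qed.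

Lemma handle_sd_neq : sd u != sd v.
Proof.
apply/eqP => /(sd_inj handle_uH handle_vH) uv.
by have := handle_lt Puv; rewrite uv ltnn.
Qed.

Lemma handle_endvertices : endvertices P = [set sd u; sd v].
Proof. exact: endvertices_path (handle_path Puv). Qed.

Lemma handle_nails : vset P :&: nails W = [set sd u; sd v].
Proof.
apply/setP => x; rewrite -(handle_meet Puv) !inE; apply: andb_id2l => xP.
apply/idP/idP => [/(subsetP (nails_wall W))//|xW].
have : x \in vset P :&: vset (wgraph W) by rewrite inE xP.
by rewrite (handle_meet Puv) => /set2P[]->; rewrite nail_wall ?handle_uH ?handle_vH.
Qed.

Lemma handle_pair x y : path_between P x y -> (x = sd u /\ y = sd v) \/ (x = sd v /\ y = sd u).
Proof. move=> /(path_between_ends (handle_path Puv)); exact: pair_eq handle_sd_neq. Qed.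

Lemma handle_mem_end w : w \in vset H -> sd w \in vset P -> w = u \/ w = v.
Proof.
move=> wH wP; have : sd w \in vset P :&: nails W by rewrite inE wP nail_wall.
by rewrite handle_nails => /set2P[] /sd_inj ->; auto; rewrite ?handle_uH ?handle_vH.
Qed.

Lemma handle_end_mem : (sd u \in vset P) * (sd v \in vset P).
Proof. exact: path_between_mem (handle_path Puv). Qed.

Lemma handle_ordered x y : endvertices P = [set x; y] -> wall_lt W x y ->
  x = sd u /\ y = sd v.
Proof.
rewrite handle_endvertices => /(pair_eq handle_sd_neq)[//|[-> ->]].
rewrite wall_ltE ?(handle_u Puv) ?(handle_v Puv) ?(handle_ub Puv) ?(handle_vb Puv) //.
by have := handle_lt Puv; case: ltngtP.
Qed.

Lemma handle_wall_lt : wall_lt W (sd u) (sd v).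
Proof.
by rewrite wall_ltE ?(handle_u Puv) ?(handle_v Puv) ?(handle_ub Puv) ?(handle_vb Puv) ?(handle_lt Puv).
Qed.

End HandleFacts.

Section HandlePairs.
Variables (P Q : sgraph V) (u v u' v' : U).
Hypotheses (Puv : handle_from P u v) (Quv : handle_from Q u' v').

Let ltE := (wall_ltE, handle_u Puv, handle_v Puv, handle_u Quv, handle_v Quv,
  handle_ub Puv, handle_vb Puv, handle_ub Quv, handle_vb Quv).

Lemma pairs_in_seriesP :
  pairs_in_series (wall_lt W) (endvertices P) (endvertices Q) <->
  (bpos v < bpos u') || (bpos v' < bpos u).
Proof.
split=> [[x1 [x2 [y1 [y2 [E1 E2 l1 l2]]]]]|h].
  have [-> ->] := handle_ordered Puv E1 l1; have [-> ->] := handle_ordered Quv E2 l2.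
  by rewrite !ltE // => /orP.
exists (sd u), (sd v), (sd u'), (sd v').
split; rewrite ?(handle_endvertices Puv) ?(handle_endvertices Quv)
  ?(handle_wall_lt Puv) ?(handle_wall_lt Quv) // !ltE //.
exact/orP.
Qed.

Lemma pairs_nestedP :
  pairs_nested (wall_lt W) (endvertices P) (endvertices Q) <->
  (bpos u < bpos u') && (bpos v' < bpos v) || (bpos u' < bpos u) && (bpos v < bpos v').
Proof.
split=> [[x1 [x2 [y1 [y2 [E1 E2 l1 l2]]]]]|h].
  have [-> ->] := handle_ordered Puv E1 l1; have [-> ->] := handle_ordered Quv E2 l2.
  by rewrite !ltE // => -[[-> _ ->]|[-> _ ->]]; rewrite ?orbT.
exists (sd u), (sd v), (sd u'), (sd v').
split; rewrite ?(handle_endvertices Puv) ?(handle_endvertices Quv)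
  ?(handle_wall_lt Puv) ?(handle_wall_lt Quv) // !ltE //.
by case/orP: h => /andP[h1 h2]; [left|right]; split.
Qed.

End HandlePairs.

(** Convexity of [X]: a row end off [X] cannot separate two row ends on it. *)
Lemma boundary_path_same_side X u v w : boundary_path W X ->
  row_end u -> row_end v -> row_end w -> sd u \in vset X -> sd v \in vset X ->
  sd w \notin vset X -> (bpos w < bpos u) = (bpos w < bpos v).
Proof.
move=> bX uE vE wE uX vX wX.
have wu : bpos w != bpos u.
  by apply: contraNneq wX => /(bpos_inj c3 wE uE) ->.
have wv : bpos w != bpos v.
  by apply: contraNneq wX => /(bpos_inj c3 wE vE) ->.
case: (ltngtP (bpos w) (bpos u)) wu => // h1 _; case: (ltngtP (bpos w) (bpos v)) wv => // h2 _.
  by case/negP: wX; exact: (boundary_path_convex bX vE uE wE).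
by case/negP: wX; exact: (boundary_path_convex bX uE vE wE).
Qed.

(** An end of [Q] is off [X1] and [Y1], hence on one side of all ends in [X1] and on one side of all
    ends in [Y1]. The second alternative arises when one of [P], [P'] has its first end in [X1] and
    the other in [Y1]. *)
Lemma non_mixing_side (Ps Qs : {set sgraph V}) P P' Q u v u' v' a b :
  non_mixing W Ps Qs -> P \in Ps -> P' \in Ps -> Q \in Qs ->
  handle_from P u v -> handle_from P' u' v' -> handle_from Q a b ->
  forall w, w = a \/ w = b ->
  ((bpos w < bpos u) = (bpos w < bpos u') /\ (bpos w < bpos v) = (bpos w < bpos v')) \/
  ((bpos w < bpos u) = (bpos w < bpos v') /\ (bpos w < bpos v) = (bpos w < bpos u')).
Proof.
case=> X1 [Y1 [X2 [Y2 [[bX1 bY1 bX2 bY2] hP hQ dis]]]] PP P'P QQ Puv Puv' Qab w wab.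
have wE : row_end w by case: wab => ->; [exact: handle_u Qab|exact: handle_v Qab].
have wQ : (sd w \in vset X2) || (sd w \in vset Y2).
  have [x [y [Qxy xX yY _]]] := hQ _ QQ.
  by case: (handle_pair Qab Qxy) => -[xE yE]; case: wab => ->; rewrite -?xE -?yE ?xX ?yY ?orbT.
have {wQ} [wX wY] : sd w \notin vset X1 /\ sd w \notin vset Y1.
  apply/andP; rewrite -negb_or; apply/negP => h.
  have /pred0P/(_ (sd w)) := dis; rewrite /= !in_vset_union h wQ //.
have S := fun X => @boundary_path_same_side X.
have [uE vE] := (handle_u Puv, handle_v Puv); have [uE' vE'] := (handle_u Puv', handle_v Puv').
have [x [y [Pxy xX yY _]]] := hP _ PP; have [x' [y' [Pxy' xX' yY' _]]] := hP _ P'P.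
case: (handle_pair Puv Pxy) => -[xE yE]; case: (handle_pair Puv' Pxy') => -[xE' yE']; subst x y x' y'.
- by left; split; [exact: (S X1)|exact: (S Y1)].
- by right; split; [exact: (S X1)|exact: (S Y1)].
- by right; split; [exact: (S Y1)|exact: (S X1)].
- by left; split; [exact: (S Y1)|exact: (S X1)].
Qed.

End Handles.

(** * Parity of chord crossings *)

Lemma big_addb_const (T : finType) (A : {pred T}) (b : bool) :
  \big[addb/false]_(x in A) b = odd #|A| && b.
Proof.
by rewrite big_const; elim: #|A| => [|n IH] //=; rewrite IH; case: (odd n); case: b {IH}.
Qed.

Lemma big_addb_odd (T : finType) (A : {set T}) (F : T -> bool) (b : bool) : odd #|A| ->
  (forall x, x \in A -> F x = b) -> \big[addb/false]_(x in A) F x = b.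
Proof. by move=> oA FE; rewrite (eq_bigr _ FE) big_addb_const oA. Qed.

Lemma odd_card_addb (T : finType) (p : pred T) :
  odd #|[set x | p x]| = \big[addb/false]_x p x.
Proof.
rewrite -[LHS]andbT -big_addb_const big_mkcond /=; apply: eq_bigr => x _.
by rewrite inE; case: (p x).
Qed.

Lemma big_addb_mem (T : finType) (A : {set T}) (F : T -> bool) :
  \big[addb/false]_x ((x \in A) && F x) = \big[addb/false]_(x in A) F x.
Proof. by rewrite [RHS]big_mkcond; apply: eq_bigr => x _; case: (x \in A). Qed.

(** Off the diagonal the terms cancel in pairs. *)
Lemma big_addb_sym n (M : 'I_n -> 'I_n -> bool) :
  (forall i j, i != j -> M i j = M j i) ->
  \big[addb/false]_(i < n) \big[addb/false]_(j < n) M i j = \big[addb/false]_(i < n) M i i.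
Proof.
move=> Ms.
have -> : \big[addb/false]_(i < n) \big[addb/false]_(j < n) M i j =
  \big[addb/false]_(i < n) \big[addb/false]_(j < n) ((i < j) && M i j) (+)
  (\big[addb/false]_(i < n) \big[addb/false]_(j < n) ((j < i) && M i j) (+)
  \big[addb/false]_(i < n) \big[addb/false]_(j < n) ((j == i) && M i j)).
  rewrite -!big_split /=; apply: eq_bigr => i _; rewrite -!big_split /=.
  apply: eq_bigr => j _; rewrite -(inj_eq val_inj) /=.
  by case: (ltngtP i j) => _; rewrite ?addbF.
rewrite addbA; have -> : \big[addb/false]_(i < n) \big[addb/false]_(j < n) ((i < j) && M i j) =
  \big[addb/false]_(i < n) \big[addb/false]_(j < n) ((j < i) && M i j).
  rewrite exchange_big /=; apply: eq_bigr => i _; apply: eq_bigr => j _.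
  by case: (ltnP j i) => // ji; rewrite Ms // -(inj_eq val_inj) /= neq_ltn ji.
rewrite addbb addFb; apply: eq_bigr => i _.
rewrite (bigD1 i) //= eqxx big1 ?addbF // => j /negbTE; rewrite -(inj_eq val_inj) /= => ->.
by [].
Qed.

Section Chords.
Variables (T : finType) (t : nat) (Ps : 'I_t -> {set T}) (lo hi : T -> nat).
Implicit Types (P Q R h : T) (A B C D E F : {set T}) (i j : 'I_t).

(** Handles are now chords with ends [lo] and [hi] among the natural numbers, and handlebars are
    classes of chords. *)
Definition series_pair P Q := (hi P < lo Q) || (hi Q < lo P).
Definition nested_pair P Q := (lo P < lo Q) && (hi Q < hi P) || (lo Q < lo P) && (hi P < hi Q).
Definition crossing_pair P Q := ~~ series_pair P Q && ~~ nested_pair P Q.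

Definition pairwiseb (p : rel T) A := [forall P in A, forall Q in A, (P != Q) ==> p P Q].

Lemma pairwisebP (p : rel T) A : reflect (forall P Q, P \in A -> Q \in A -> P != Q -> p P Q)
  (pairwiseb p A).
Proof.
apply: (iffP forall_inP) => [h P Q PA QA PQ|h P PA].
  by have /forall_inP/(_ _ QA)/implyP := h _ PA; exact.
by apply/forall_inP => Q QA; apply/implyP; exact: h.
Qed.

(** The parity of the number of ends of [Q] between those of [P], written as a sum to match the jump
    of [below] across [P]. *)
Definition cross P Q := (lo Q < lo P) (+) (hi Q < lo P) (+) (lo Q < hi P) (+) (hi Q < hi P).

(** The value that the potential of a cycle with handles [q] takes at boundary position [n]. *)
Definition below (q : pred T) n := \big[addb/false]_P (q P && ((lo P < n) (+) (hi P < n))).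

Lemma below_cross (q : pred T) P :
  below q (lo P) (+) below q (hi P) = \big[addb/false]_Q (q Q && cross P Q).
Proof. by rewrite -big_split /=; apply: eq_bigr => Q _; rewrite -andb_addr /cross -!addbA. Qed.

Hypothesis lohi : forall i P, P \in Ps i -> lo P < hi P.
Hypothesis ends_neq : forall i j P Q, P \in Ps i -> Q \in Ps j -> P != Q ->
  [/\ lo P != lo Q, lo P != hi Q, hi P != lo Q & hi P != hi Q].
Hypothesis Psdis : forall i j P, P \in Ps i -> P \in Ps j -> i = j.
Hypothesis side : forall i j P P' Q n, i != j -> P \in Ps i -> P' \in Ps i -> Q \in Ps j ->
  n = lo Q \/ n = hi Q ->
  ((n < lo P) = (n < lo P') /\ (n < hi P) = (n < hi P')) \/
  ((n < lo P) = (n < hi P') /\ (n < hi P) = (n < lo P')).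
Hypothesis pureb : forall i, [|| pairwiseb series_pair (Ps i), pairwiseb nested_pair (Ps i)
  | pairwiseb crossing_pair (Ps i)].

Local Notation series i := (pairwiseb series_pair (Ps i)).

Lemma cross_sym i j P Q : P \in Ps i -> Q \in Ps j -> P != Q -> cross P Q = cross Q P.
Proof. by move=> Pi Qj /(ends_neq Pi Qj)[]; rewrite /cross; lia. Qed.

Lemma cross_crossing i P Q : P \in Ps i -> Q \in Ps i -> P != Q ->
  cross P Q = crossing_pair P Q.
Proof.
move=> Pi Qi /(ends_neq Pi Qi)[]; have := lohi Pi; have := lohi Qi.
by rewrite /cross /crossing_pair /series_pair /nested_pair; lia.
Qed.

Lemma nested_not_series i P Q : P \in Ps i -> Q \in Ps i -> nested_pair P Q ->
  ~~ series_pair P Q.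
Proof.
move=> Pi Qi; have := lohi Pi; have := lohi Qi.
by rewrite /series_pair /nested_pair; lia.
Qed.

Lemma crossing_pair_const i P Q P' Q' : P \in Ps i -> Q \in Ps i -> P != Q ->
  P' \in Ps i -> Q' \in Ps i -> P' != Q' -> crossing_pair P Q = crossing_pair P' Q'.
Proof.
move=> Pi Qi PQ Pi' Qi' PQ'; case/or3P: (pureb i) => /pairwisebP h.
- by rewrite /crossing_pair !h.
- by rewrite /crossing_pair !h // !andbF.
- by rewrite !h.
Qed.

(** Within one class this is purity. Between two classes, [side] says that an end of [Q] sees [P]
    and [P'] alike up to exchanging their ends, and [cross] is invariant under this exchange. *)
Lemma cross_const i j P Q P' Q' : P \in Ps i -> Q \in Ps j -> P != Q ->
  P' \in Ps i -> Q' \in Ps j -> P' != Q' -> cross P Q = cross P' Q'.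
Proof.
move=> Pi Qj PQ Pi' Qj' PQ'; case: (eqVneq i j) => [ij|ij].
  by subst j; rewrite !(@cross_crossing i) //; exact: (@crossing_pair_const i).
have half i0 j0 P0 P0' Q0 : i0 != j0 -> P0 \in Ps i0 -> P0' \in Ps i0 -> Q0 \in Ps j0 ->
    cross P0 Q0 = cross P0' Q0.
  move=> n0 h1 h2 h3; rewrite /cross.
  have := side n0 h1 h2 h3 (or_introl erefl); have := side n0 h1 h2 h3 (or_intror erefl).
  by case=> -[-> ->] [] [-> ->]; do 4!case: (_ < _).
have PQ2 : P' != Q by apply: contraNneq ij => E; apply/eqP; apply: Psdis Pi' _; rewrite E.
rewrite (half i j P P' Q) // (cross_sym Pi' Qj) // (half j i Q Q' P') 1?eq_sym //.
by rewrite -(cross_sym Pi' Qj').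
Qed.

(** Were [n] between the ends of one chord of the class, [side] would put it between the ends of
    every other one, which chords in series exclude. A single chord could still straddle [n], hence
    the bound on the size. *)
Lemma series_side i j Q n : series i -> 1 < #|Ps i| -> i != j -> Q \in Ps j ->
  n = lo Q \/ n = hi Q -> forall R R', R \in Ps i -> R' \in Ps i ->
  (n < lo R) = (n < lo R') /\ (n < hi R) = (n < lo R').
Proof.
move=> /pairwisebP ser c1 ij Qj nQ.
have main R R' : R \in Ps i -> R' \in Ps i -> R != R' ->
    (n < lo R) = (n < lo R') /\ (n < hi R) = (n < lo R').
  move=> Ri Ri' RR; have := side ij Ri Ri' Qj nQ.
  have := ser _ _ Ri Ri' RR; have := lohi Ri; have := lohi Ri'.
  by rewrite /series_pair; lia.
have loop R : R \in Ps i -> (n < hi R) = (n < lo R).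
  move=> Ri; have [R' Ri' RR] : exists2 R', R' \in Ps i & R != R'.
    have : 0 < #|Ps i :\ R| by move: c1; rewrite (cardsD1 R) Ri.
    by rewrite card_gt0 => /set0Pn[R' /setD1P[n1 n2]]; exists R'; rewrite 1?eq_sym.
  by have [-> ->] := main R R' Ri Ri' RR.
move=> R R' Ri Ri'; case: (eqVneq R R') => [<-|]; last exact: main.
by split=> //; exact: loop.
Qed.

Lemma series_cross i j P Q : series i -> 1 < #|Ps i| -> P \in Ps i -> Q \in Ps j ->
  P != Q -> cross P Q = false.
Proof.
move=> ser c1 Pi Qj PQ; case: (eqVneq i j) => [ij|ij].
  subst j; rewrite (cross_crossing Pi Qj PQ).
  by move/pairwisebP: ser => /(_ _ _ Pi Qj PQ); rewrite /crossing_pair => ->.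
have [_ h1] := series_side ser c1 ij Qj (or_introl erefl) Pi Pi.
have [_ h2] := series_side ser c1 ij Qj (or_intror erefl) Pi Pi.
by rewrite /cross h1 h2; do 2!case: (_ < _).
Qed.

(** Two nested or crossing chords overlap, so all first ends in such a class precede all second
    ends. *)
Lemma not_series_pair i P Q : ~~ series i -> P \in Ps i -> Q \in Ps i ->
  lo P < hi Q.
Proof.
move=> nser Pi Qi; case: (eqVneq P Q) => [->|PQ]; first exact: lohi Qi.
have ns : ~~ series_pair P Q.
  case/or3P: (pureb i) nser => /pairwisebP h; first by move/pairwisebP: h => ->.
    by move=> _; exact: nested_not_series Pi Qi (h _ _ Pi Qi PQ).
  by move=> _; have /andP[] := h _ _ Pi Qi PQ.
have [_ + _ _] := ends_neq Pi Qi PQ; move: ns; rewrite /series_pair; lia.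
Qed.

Lemma not_series_side i j Q n : ~~ series i -> i != j -> Q \in Ps j ->
  n = lo Q \/ n = hi Q -> forall R R', R \in Ps i -> R' \in Ps i ->
  (n < lo R) = (n < lo R').
Proof.
move=> nser ij Qj nQ R R' Ri Ri'; have := side ij Ri Ri' Qj nQ.
have := not_series_pair nser Ri Ri'; have := not_series_pair nser Ri' Ri.
have := lohi Ri; have := lohi Ri'; lia.
Qed.

Lemma big_addb_handlebars A (F : T -> bool) : A \subset \bigcup_i Ps i ->
  \big[addb/false]_(P in A) F P = \big[addb/false]_i \big[addb/false]_(P in Ps i :&: A) F P.
Proof.
move=> /subsetP AP; rewrite (exchange_big_dep (fun P => P \in A)) /=; last first.
  by move=> i P _; rewrite inE => /andP[].
apply: eq_bigr => P PA; have /bigcupP[i _ Pi] := AP _ PA.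
by rewrite (big_pred1 i) // => j; rewrite inE PA andbT; apply/idP/eqP => [Pj|->//]; exact: Psdis Pj Pi.
Qed.

(** By [cross_const] each block of the double sum is constant, so an odd number of chords can be
    replaced by one representative, [p i] or [q i]. Off-diagonal blocks cancel by symmetry, and the
    diagonal ones tell which classes are crossing. *)
Lemma sum_cross_crossing A B : A \subset \bigcup_i Ps i -> B \subset \bigcup_i Ps i ->
  [disjoint A & B] -> (forall i, odd #|Ps i :&: A|) -> (forall i, odd #|Ps i :&: B|) ->
  \big[addb/false]_(P in A) \big[addb/false]_(Q in B) cross P Q =
  odd #|[set i | pairwiseb crossing_pair (Ps i)]|.
Proof.
move=> AP BP AB oA oB.
have rep C i : odd #|Ps i :&: C| -> {P | P \in Ps i :&: C}.
  by move=> o; apply/sigW/set0Pn; rewrite -card_gt0 odd_gt0.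
pose p i := sval (rep A i (oA i)); pose q i := sval (rep B i (oB i)).
have pP i : p i \in Ps i :&: A := svalP (rep A i (oA i)).
have qP i : q i \in Ps i :&: B := svalP (rep B i (oB i)).
have neq P Q : P \in A -> Q \in B -> P != Q.
  by move=> PA QB; apply: contraTneq QB => <-; rewrite (disjointFr AB).
rewrite odd_card_addb big_addb_handlebars //.
transitivity (\big[addb/false]_i \big[addb/false]_j cross (p i) (q j)).
  apply: eq_bigr => i _; apply: big_addb_odd => // P /setIP[Pi PA].
  rewrite big_addb_handlebars //; apply: eq_bigr => j _.
  apply: big_addb_odd => // Q /setIP[Qj QB].
  have /setIP[pi pA] := pP i; have /setIP[qj qB] := qP j.
  by apply: (@cross_const i j) => //; apply: neq.
have pq i j : p i != q j.
  by have /setIP[_ pA] := pP i; have /setIP[_ qB] := qP j; exact: neq.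
rewrite big_addb_sym => [|i j ij]; last first.
  have /setIP[pi _] := pP i; have /setIP[qi _] := qP i.
  have /setIP[pj _] := pP j; have /setIP[qj _] := qP j.
  by rewrite (cross_sym pi qj) //; apply: (@cross_const j i); rewrite // 1?eq_sym.
apply: eq_bigr => i _; have /setIP[pi _] := pP i; have /setIP[qi _] := qP i.
rewrite (cross_crossing pi qi (pq i i)).
apply/idP/pairwisebP => [h P Q Pi Qi PQ|h]; last exact: h.
by rewrite (@crossing_pair_const i P Q (p i) (q i)).
Qed.

Lemma below_set A n : below (mem A) n = \big[addb/false]_(P in A) ((lo P < n) (+) (hi P < n)).
Proof. exact: big_addb_mem. Qed.

Lemma below_cross_set A P :
  below (mem A) (lo P) (+) below (mem A) (hi P) = \big[addb/false]_(Q in A) cross P Q.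
Proof. by rewrite below_cross; exact: big_addb_mem. Qed.

(** * Three sets of chords, with one class in series and one not *)

Section ThreeSets.
Variables (i j : 'I_t).
Hypotheses (seri : series i) (ci : 1 < #|Ps i|) (nserj : ~~ series j).

Definition outside k A n := \big[addb/false]_(P in A :\: Ps k) ((lo P < n) (+) (hi P < n)).

Lemma below_split k A n : below (mem A) n =
  \big[addb/false]_(P in Ps k :&: A) ((lo P < n) (+) (hi P < n)) (+) outside k A n.
Proof. by rewrite below_set (big_setID (Ps k)) /= setIC. Qed.

Lemma eq_outside k A n n' : A \subset \bigcup_i Ps i ->
  (forall l Q m, k != l -> Q \in Ps l -> m = lo Q \/ m = hi Q -> (m < n) = (m < n')) ->
  outside k A n = outside k A n'.
Proof.
move=> /subsetP AP h; apply: eq_bigr => P /setDP[PA Pk]; have /bigcupP[l _ Pl] := AP _ PA.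
have kl : k != l by apply: contraNneq Pk => ->.
by congr (_ (+) _); apply: (h l P) => //; [left|right].
Qed.

(** Inside class [j] no second end precedes a first end, so each pair of a chord in [A] and one in
    [B] is counted by exactly one of the two sums; the number of these pairs is odd. The remaining
    term [outside] is the same at all first ends of the class and is added an odd number of
    times. *)
Lemma sum_below_not_series A B P0 : A \subset \bigcup_i Ps i -> B \subset \bigcup_i Ps i ->
  [disjoint A & B] -> odd #|Ps j :&: A| -> odd #|Ps j :&: B| -> P0 \in Ps j ->
  \big[addb/false]_(P in Ps j :&: A) below (mem B) (lo P) (+)
  \big[addb/false]_(P in Ps j :&: B) below (mem A) (lo P) =
  outside j A (lo P0) (+) outside j B (lo P0) (+) true.
Proof.
move=> AP BP AB oA oB P0j.
have half (C D : {set T}) : D \subset \bigcup_i Ps i -> odd #|Ps j :&: C| ->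
    \big[addb/false]_(P in Ps j :&: C) below (mem D) (lo P) =
    \big[addb/false]_(P in Ps j :&: C) \big[addb/false]_(Q in Ps j :&: D) (lo Q < lo P)
    (+) outside j D (lo P0).
  move=> DP oC; rewrite -[outside _ _ _]andTb -oC -big_addb_const -big_split /=.
  apply: eq_bigr => P /setIP[Pj PC]; rewrite (below_split j); congr (_ (+) _).
    apply: eq_bigr => Q /setIP[Qj QD].
    by have := not_series_pair nserj Pj Qj; case: ltngtP; rewrite ?addbF.
  by apply: eq_outside => // l Q m jl Ql mQ; apply: (not_series_side nserj jl Ql mQ).
rewrite (half A B) // (half B A) // [X in _ (+) (X (+) _)]exchange_big /=.
rewrite addbACA -big_split /= [X in X (+) _](_ : _ = true) ?addTb.
  by rewrite addbT addbC.
under eq_bigr do rewrite -big_split /=.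
transitivity (\big[addb/false]_(P in Ps j :&: A) \big[addb/false]_(Q in Ps j :&: B) true).
  apply: eq_bigr => P /setIP[Pj PA]; apply: eq_bigr => Q /setIP[Qj QB].
  have PQ : P != Q by apply: contraTneq QB => <-; rewrite (disjointFr AB).
  by have [] := ends_neq Pj Qj PQ; case: ltngtP.
by rewrite !big_addb_const oA oB.
Qed.

(** A chord in series with [P] has both ends on the same side of [lo P], so only other classes
    contribute. *)
Lemma below_series A P P0 : A \subset \bigcup_i Ps i -> P \in Ps i -> P \notin A ->
  P0 \in Ps i -> below (mem A) (lo P) = outside i A (lo P0).
Proof.
move=> AP Pi PA P0i; rewrite (below_split i) big1 ?addFb => [|Q /setIP[Qi QA]].
  by apply: eq_outside => // l Q m il Ql mQ; case: (series_side seri ci il Ql mQ Pi P0i).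
have PQ : P != Q by apply: contraNneq PA => ->.
move/pairwisebP: seri => /(_ _ _ Pi Qi PQ); rewrite /series_pair.
by have := lohi Pi; have := lohi Qi; have [] := ends_neq Pi Qi PQ; lia.
Qed.

(* Double counting: seen from the ends in [Ps j] the three sides have odd sum,
   seen from those in [Ps i] the sum is even. *)
Lemma no_three_sets A B C h1 h2 h3 :
  A \subset \bigcup_i Ps i -> B \subset \bigcup_i Ps i -> C \subset \bigcup_i Ps i ->
  [disjoint A & B] -> [disjoint A & C] -> [disjoint B & C] ->
  odd #|Ps j :&: A| -> odd #|Ps j :&: B| -> odd #|Ps j :&: C| ->
  h1 \in Ps i :&: A -> h2 \in Ps i :&: B -> h3 \in Ps i :&: C ->
  (forall P P', P \in A -> P' \in A -> below (mem B) (lo P) (+) below (mem C) (lo P) =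
     below (mem B) (lo P') (+) below (mem C) (lo P')) ->
  (forall P P', P \in B -> P' \in B -> below (mem A) (lo P) (+) below (mem C) (lo P) =
     below (mem A) (lo P') (+) below (mem C) (lo P')) ->
  (forall P P', P \in C -> P' \in C -> below (mem A) (lo P) (+) below (mem B) (lo P) =
     below (mem A) (lo P') (+) below (mem B) (lo P')) -> False.
Proof.
move=> AP BP CP AB AC BC oA oB oC /setIP[h1i h1A] /setIP[h2i h2B] /setIP[h3i h3C] cA cB cC.
have /set0Pn[P0 /setIP[P0j _]] : Ps j :&: A != set0 by rewrite -card_gt0 odd_gt0.
have sum D E F h : odd #|Ps j :&: D| -> h \in D ->
    (forall P P', P \in D -> P' \in D -> below (mem E) (lo P) (+) below (mem F) (lo P) =
     below (mem E) (lo P') (+) below (mem F) (lo P')) ->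
    \big[addb/false]_(P in Ps j :&: D) below (mem E) (lo P) (+)
    \big[addb/false]_(P in Ps j :&: D) below (mem F) (lo P) =
    below (mem E) (lo h) (+) below (mem F) (lo h).
  by move=> oD hD cD; rewrite -big_split; apply: big_addb_odd => // P /setIP[_ PD]; exact: cD.
have := sum _ _ _ _ oA h1A cA; have := sum _ _ _ _ oB h2B cB; have := sum _ _ _ _ oC h3C cC.
have := sum_below_not_series AP BP AB oA oB P0j.
have := sum_below_not_series AP CP AC oA oC P0j.
have := sum_below_not_series BP CP BC oB oC P0j.
have out h D E : h \in Ps i -> h \in D -> [disjoint D & E] -> E \subset \bigcup_i Ps i ->
    below (mem E) (lo h) = outside i E (lo h1).
  by move=> hi' hD DE EP; apply: below_series; rewrite ?(disjointFr DE hD).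
have [BA CA CB] : [/\ [disjoint B & A], [disjoint C & A] & [disjoint C & B]].
  by split; rewrite disjoint_sym.
rewrite (out _ _ _ h1i h1A AB BP) (out _ _ _ h1i h1A AC CP) (out _ _ _ h2i h2B BA AP).
rewrite (out _ _ _ h2i h2B BC CP) (out _ _ _ h3i h3C CA AP) (out _ _ _ h3i h3C CB BP).
move: (outside i A _) (outside i B _) (outside i C _)
  (outside j A _) (outside j B _) (outside j C _) => a1 b1 c1 a2 b2 c2.
move: (\big[_/_]_(P in Ps j :&: A) below (mem B) _)
  (\big[_/_]_(P in Ps j :&: A) below (mem C) _)
  (\big[_/_]_(P in Ps j :&: B) below (mem A) _)
  (\big[_/_]_(P in Ps j :&: B) below (mem C) _)
  (\big[_/_]_(P in Ps j :&: C) below (mem A) _)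
  (\big[_/_]_(P in Ps j :&: C) below (mem B) _) => x y z u v w.
clear; case: a1 b1 c1 a2 b2 c2 => [] [] [] [] [] [] /=;
by case: x y z u v w => [] [] [] [] [] [].
Qed.

End ThreeSets.

(** The change of [below] across [P] is a sum of crossings. Classes in series contribute nothing;
    any other class is met an odd number of times by [A] and by [B], and contributes the same parity
    to both. *)
Lemma cross_two_sets i A B P : (forall k, series k -> 1 < #|Ps k|) ->
  A \subset \bigcup_i Ps i -> B \subset \bigcup_i Ps i -> P \in Ps i ->
  P \notin A -> P \notin B ->
  (forall k, series k \/ odd #|Ps k :&: A|) -> (forall k, series k \/ odd #|Ps k :&: B|) ->
  below (mem A) (lo P) (+) below (mem B) (lo P) = below (mem A) (hi P) (+) below (mem B) (hi P).
Proof.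
move=> c1 AP BP Pi PA PB oA oB; have neq D Q : P \notin D -> Q \in D -> P != Q.
  by move=> PD QD; apply: contraNneq PD => ->.
suff : \big[addb/false]_(Q in A) cross P Q = \big[addb/false]_(Q in B) cross P Q.
  by rewrite -!below_cross_set; do 4!case: below.
rewrite !big_addb_handlebars //; apply: eq_bigr => k _.
case: (boolP (series k)) => [ser|nser].
  rewrite !big1 // => Q /setIP[Qk QD]; rewrite (cross_sym Pi Qk) ?(neq _ _ _ QD) //;
    by rewrite (series_cross ser (c1 k ser) Qk Pi) // eq_sym (neq _ _ _ QD).
have [oAk oBk] : odd #|Ps k :&: A| /\ odd #|Ps k :&: B|.
  by case: (oA k) (oB k) => [s|?] [s'|?] //; rewrite ?s ?s' in nser.
have /set0Pn[Q0 /setIP[Q0k Q0A]] : Ps k :&: A != set0 by rewrite -card_gt0 odd_gt0.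
rewrite (big_addb_odd (b := cross P Q0) oAk) ?(big_addb_odd (b := cross P Q0) oBk) //;
  by move=> Q /setIP[Qk QD]; apply: (@cross_const i k) => //; [apply: (neq _ _ _ QD)|apply: (neq _ _ _ Q0A)].
Qed.

(** * All classes in series *)

Section AllSeries.
Hypotheses (ser : forall i, series i) (c1 : forall i, 1 < #|Ps i|).

Lemma all_series_not_between i j P Q n : P \in Ps i -> Q \in Ps j -> P != Q ->
  n = lo P \/ n = hi P -> (n < lo Q) = (n < hi Q).
Proof.
move=> Pi Qj PQ nP; case: (eqVneq j i) => [ij|ij].
  subst j; have /pairwisebP/(_ _ _ Pi Qj PQ) := ser i; rewrite /series_pair.
  by have := lohi Pi; have := lohi Qj; lia.
by have [_ ->] := series_side (ser j) (c1 j) ij Pi nP Qj Qj.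
Qed.

(** By [all_series_not_between], a chord in [q] has both ends or neither before [n]. *)
Lemma all_series_below i (q : pred T) P n : P \in Ps i -> ~~ q P ->
  (forall Q, q Q -> Q \in \bigcup_i Ps i) -> n = lo P \/ n = hi P -> below q n = false.
Proof.
move=> Pi nqP qP nP; apply: big1 => Q _; case: (boolP (q Q)) => //= qQ.
have /bigcupP[j _ Qj] := qP _ qQ; have PQ : P != Q by apply: contraNneq nqP => ->.
have := all_series_not_between Pi Qj PQ nP; have [] := ends_neq Pi Qj PQ.
by case: nP => ->; lia.
Qed.

End AllSeries.

(** By [series_side], comparisons between different classes do not depend on the chords chosen, so
    the [h] can be replaced by the [g] except for one comparison inside class [i1]. It occurs in
    both instances of the hypothesis; adding them cancels it, and antisymmetry of the order makes
    the rest contradictory. *)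
Lemma no_three_series i1 i2 i3 (h g : 'I_t -> T) :
  (forall i, series i) -> (forall i, 1 < #|Ps i|) -> i1 != i2 -> i1 != i3 -> i2 != i3 ->
  (forall i, h i \in Ps i) -> (forall i, g i \in Ps i) ->
  (forall a b k l, (lo (g a) < lo (h k)) (+) (lo (g b) < lo (h k)) =
                   (lo (g a) < lo (h l)) (+) (lo (g b) < lo (h l))) -> False.
Proof.
move=> ser c1 n12 n13 n23 hP gP cst.
have G a b : a != b -> (lo (g a) < lo (h b)) = (lo (g a) < lo (g b)).
  by rewrite eq_sym => ab; case: (series_side (ser b) (c1 b) ab (gP a) (or_introl erefl) (hP b) (gP b)).
have N a b : a != b -> (lo (g b) < lo (g a)) = ~~ (lo (g a) < lo (g b)).
  move=> ab; have gab : g a != g b.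
    by apply: contraNneq ab => E; apply/eqP; apply: Psdis (gP a) _; rewrite E.
  by case: (ends_neq (gP a) (gP b) gab); case: ltngtP.
have := cst i1 i2 i1 i3; have := cst i1 i3 i1 i2.
have [n21 n31 n32] : [/\ i2 != i1, i3 != i1 & i3 != i2] by rewrite !(eq_sym i3) eq_sym.
rewrite (G _ _ n21) (G _ _ n31) (G _ _ n12) (G _ _ n13) (G _ _ n23) (G _ _ n32).
rewrite (N _ _ n12) (N _ _ n13) (N _ _ n23).
by case: (_ < lo (h i1)); do 3!case: (_ < lo (g _)).
Qed.

End Chords.

(** * Graphs in the class *)

Lemma path_edge_ends (V : finType) (P : sgraph V) x y : path_between P x y ->
  [set x; y] \in eset P -> eset P = [set [set x; y]] /\ vset P = [set x; y].
Proof.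
case=> p [Up EV EE] <-; rewrite EV EE inE -!/(path_edges _ _).
case: p Up {EV EE} => [|z p] // Up; rewrite path_edges_cons inE => h.
have -> : p = [::].
  case: p Up h => // w p Up /orP[/eqP E|/path_edges_sub/(_ (set21 _ _)) xn]; last first.
    by case/andP: Up; rewrite xn.
  have : last x [:: z, w & p] \in [set x; z] by rewrite -E set22.
  case/andP: Up => xn /andP[zn _] /set2P[] lx.
    by move: xn; rewrite -{1}lx /= inE mem_last orbT.
  by move: zn; rewrite -{1}lx /= mem_last.
rewrite /path_edges /=; split; apply/setP => v; by rewrite !inE.
Qed.

Lemma generated_sum (Gamma : zmodType) (S : Gamma -> Prop) (I : Type) (s : seq I)
    (p : pred I) (F : I -> Gamma) :
  (forall i, p i -> generated S (F i)) -> generated S (\sum_(i <- s | p i) F i)%R.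
Proof.
move=> h K K0 KB KS; have KD a b : K a -> K b -> K (a + b)%R.
  by move=> Ka Kb; rewrite -[b]opprK; apply: (KB) => //; rewrite -sub0r; apply: (KB).
by elim/big_ind: _ => // i /h; exact.
Qed.

Section Witness.
Variables (V : finType) (Gamma : zmodType) (A : Gamma -> Prop) (G : sgraph V)
  (gamma : {set V} -> Gamma) (W : wall V) (t : nat) (Ps : 'I_t -> {set sgraph V}).
Notation c := (wcols W).
Notation r := (wrows W).
Notation U := ('I_c.*2 * 'I_r)%type.
Notation H := (elementary_wall c r).
Notation S := (wsub W).
Notation sd := (sd_vertex (wsub W)).
Notation c3 := (wcols_ge3 W).
Implicit Types (u v w : U) (e : {set U}) (P Q C : sgraph V) (i j k : 'I_t).

Variables fl fr : sgraph V -> U.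
Hypothesis handle_fromP : forall P, handle W P -> handle_from P (fl P) (fr P).
Hypothesis handlebars : forall i, handlebar W (Ps i).
Hypothesis nonempty : forall i, Ps i != set0.
Hypothesis bars_disjoint :
  forall i j, i != j -> vdisjoint (graphs_union (Ps i)) (graphs_union (Ps j)).
Hypothesis bars_non_mixing : forall i j, i != j -> non_mixing W (Ps i) (Ps j).
Hypotheses (o1 : O1 G W Ps) (o2 : O2 gamma W) (o3 : O3 A gamma Ps)
  (o4 : O4 A gamma Ps) (o5 : O5 A gamma W Ps).

Let lo P := bpos (fl P).
Let hi P := bpos (fr P).
Let Hd := \bigcup_i Ps i.

Lemma bar_handle i P : P \in Ps i -> handle_from P (fl P) (fr P).
Proof. by move=> Pi; apply: handle_fromP; case: (handlebars i) => + _ _ _; exact. Qed.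

Lemma bar_vset i P x : P \in Ps i -> x \in vset P -> x \in vset (graphs_union (Ps i)).
Proof. by move=> Pi xP; apply/bigcupP; exists P. Qed.

Lemma bars_vdisjoint i j P Q x : P \in Ps i -> Q \in Ps j -> x \in vset P ->
  x \in vset Q -> P = Q.
Proof.
move=> Pi Qj xP xQ; case: (eqVneq i j) => [ij|ij]; last first.
  by have := bars_disjoint ij => /disjointFr/(_ (bar_vset Pi xP)); rewrite (bar_vset Qj xQ).
subst j; apply/eqP; case: (handlebars i) => _ h _ _; apply: contraT => PQ.
by have /disjointFr/(_ xP) := h P Q Pi Qj PQ; rewrite xQ.
Qed.

Lemma bars_inj i j P : P \in Ps i -> P \in Ps j -> i = j.
Proof.
move=> Pi Pj; apply/eqP; apply: contraT => /bars_disjoint/disjointFr.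
have [h _] := handle_end_mem (bar_handle Pi).
by move/(_ _ (bar_vset Pi h)); rewrite (bar_vset Pj h).
Qed.

Lemma bar_lohi i P : P \in Ps i -> lo P < hi P.
Proof. by move/bar_handle/handle_lt. Qed.

Lemma bar_ends_neq i j P Q : P \in Ps i -> Q \in Ps j -> P != Q ->
  [/\ lo P != lo Q, lo P != hi Q, hi P != lo Q & hi P != hi Q].
Proof.
move=> Pi Qj PQ; have hP := bar_handle Pi; have hQ := bar_handle Qj.
have [lP rP] := handle_end_mem hP; have [lQ rQ] := handle_end_mem hQ.
have neq u v : row_end u -> row_end v -> sd u \in vset P -> sd v \in vset Q -> bpos u != bpos v.
  move=> uE vE uP vQ; apply: contraNneq PQ => /(bpos_inj c3 uE vE) uv; apply/eqP.
  by apply: bars_vdisjoint Pi Qj uP _; rewrite uv.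
by split; apply: neq => //;
  first [exact: handle_u hP|exact: handle_v hP|exact: handle_u hQ|exact: handle_v hQ].
Qed.

Lemma bars_side i j P P' Q n : i != j -> P \in Ps i -> P' \in Ps i -> Q \in Ps j ->
  n = lo Q \/ n = hi Q ->
  ((n < lo P) = (n < lo P') /\ (n < hi P) = (n < hi P')) \/
  ((n < lo P) = (n < hi P') /\ (n < hi P) = (n < lo P')).
Proof.
move=> ij Pi Pi' Qj; have main := non_mixing_side (bars_non_mixing ij) Pi Pi' Qj
  (bar_handle Pi) (bar_handle Pi') (bar_handle Qj).
by case=> ->; [apply: main; left|apply: main; right].
Qed.

(** Disjoint handles have different end pairs, so quantifying over [end_pairs] loses no pair of
    handles. *)
Lemma pairwise_on_ends (R : {set V} -> {set V} -> Prop) (p : rel (sgraph V)) i :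
  (forall P Q, P \in Ps i -> Q \in Ps i -> R (endvertices P) (endvertices Q) <-> p P Q) ->
  pairwise_on R (end_pairs (Ps i)) <-> pairwiseb p (Ps i).
Proof.
move=> Rp; split=> [h|/pairwisebP h].
  apply/pairwisebP => P Q Pi Qi PQ; apply/(Rp _ _ Pi Qi).
  apply: h; try exact: imset_f.
  apply: contraNneq PQ => E; apply/eqP.
  have hP := bar_handle Pi; have [l _] := handle_end_mem hP.
  apply: (bars_vdisjoint Pi Qi l).
  have : sd (fl P) \in endvertices Q by rewrite -E (handle_endvertices hP) set21.
  rewrite (handle_endvertices (bar_handle Qi)) => /set2P[]->;
    by case: (handle_end_mem (bar_handle Qi)).
move=> _ _ /imsetP[P Pi ->] /imsetP[Q Qi ->] PQ; apply/(Rp _ _ Pi Qi); apply: h => //.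
by apply: contraNneq PQ => ->.
Qed.

Lemma in_seriesE i : in_series W (Ps i) <-> pairwiseb (series_pair lo hi) (Ps i).
Proof. by apply: pairwise_on_ends => P Q Pi Qi; exact: (pairs_in_seriesP (bar_handle Pi) (bar_handle Qi)). Qed.

Lemma nestedE i : nested W (Ps i) <-> pairwiseb (nested_pair lo hi) (Ps i).
Proof. by apply: pairwise_on_ends => P Q Pi Qi; exact: (pairs_nestedP (bar_handle Pi) (bar_handle Qi)). Qed.

Lemma crossingE i : crossing W (Ps i) <-> pairwiseb (crossing_pair lo hi) (Ps i).
Proof.
apply: pairwise_on_ends => P Q Pi Qi; rewrite /pairs_crossing /crossing_pair.
have hP := bar_handle Pi; have hQ := bar_handle Qi.
rewrite (pairs_in_seriesP hP hQ) (pairs_nestedP hP hQ).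
by split=> [[/negP-> /negP->]|/andP[/negP ? /negP ?]].
Qed.

Lemma bars_pure i : [|| pairwiseb (series_pair lo hi) (Ps i),
  pairwiseb (nested_pair lo hi) (Ps i) | pairwiseb (crossing_pair lo hi) (Ps i)].
Proof.
case: (handlebars i) => _ _ [h|h|h] _; apply/or3P.
- by apply: Or31; apply: (proj1 (in_seriesE i)).
- by apply: Or32; apply: (proj1 (nestedE i)).
- by apply: Or33; apply: (proj1 (crossingE i)).
Qed.

(** If the value of [P] were 0, a choice of handles containing [P] would by O3 have its sum in [A],
    but also in the subgroup generated by the other handlebars, against O4. *)
Lemma bar_value_neq0 i P : P \in Ps i -> gvalue gamma P <> 0%R.
Proof.
(* The [P] inside [odflt] is a mere default: every handlebar is nonempty, so [pick] succeeds. *)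
move=> Pi P0; pose p j := if j == i then P else odflt P [pick Q in Ps j].
have pP j : p j \in Ps j.
  rewrite /p; case: eqP => [->//|_]; case: pickP => [//|E].
  by case/set0Pn: (nonempty j) => Q; rewrite E.
apply: (o4 (i := i) _ (o3 pP)); rewrite (bigD1 i) //= {1}/p eqxx P0 add0r.
by apply: generated_sum => j ji K _ _; apply; exists j, (p j).
Qed.

(** A handle meets the wall only in its two ends, so a common edge joins them and is the entire
    handle. The handle would then be a path between nails in the wall, of value 0 by O2. *)
Lemma bar_wall_edges i P e g : P \in Ps i -> e \in eset H -> g \in eset P ->
  g \in eset (sd_path S e) -> False.
Proof.
move=> Pi eH gP ge; have hP := bar_handle Pi.
have gW : g \in eset (wgraph W) by apply/eset_imageP; exists e.
have gE : g = [set sd (fl P); sd (fr P)].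
  apply/eqP; rewrite eqEcard; have [-> _] := edgeP gP.
  rewrite cards2 (handle_sd_neq hP) andbT; apply/subsetP => x xg.
  by rewrite -(handle_meet hP) inE (incident_in_vset gP xg) (incident_in_vset gW xg).
rewrite gE in gP gW.
have [EE EV] := path_edge_ends (handle_path hP) gP.
have lN := nail_wall (handle_uH hP); have rN := nail_wall (handle_vH hP).
apply: (bar_value_neq0 Pi); apply: o2.
  rewrite /subgraph EE EV sub1set gW andbT; apply/subsetP => x /set2P[]->;
    exact: (subsetP (nails_wall W)).
split; last by rewrite EE; apply/set0Pn; exists [set sd (fl P); sd (fr P)]; rewrite inE.
exists (sd (fl P)), (sd (fr P)); split=> //; first exact: handle_path hP.
by move=> x; rewrite EV !inE => /orP[]->.
Qed.

Let wall_paths := [set sd_path S e | e in eset H].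

Lemma graph_links : link_system G (wall_paths :|: Hd) (nails W).
Proof.
have wl := wall_links W.
have meet P i L : P \in Ps i -> L \in wall_paths -> vset L :&: vset P \subset nails W.
  move=> Pi /imsetP[e eH ->]; apply/subsetP => x /setIP[xL xP].
  have hP := bar_handle Pi.
  have : x \in vset P :&: vset (wgraph W) by rewrite inE xP (vset_image_path eH xL).
  by rewrite (handle_meet hP) => /set2P[]->; apply: nail_wall; [apply: handle_uH hP|apply: handle_vH hP].
split.
- move=> L /setUP[/(link_path wl)//|/bigcupP[i _ Li]].
  have hL := bar_handle Li; exists (sd (fl L)), (sd (fr L)).
  by split; [exact: handle_path hL|exact: handle_sd_neq hL|exact: handle_nails hL].
- move=> L M /setUP[Lw|/bigcupP[i _ Li]] /setUP[Mw|/bigcupP[j _ Mj]] LM.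
  + exact: (link_meet wl).
  + exact: meet Mj Lw.
  + by rewrite setIC; exact: meet Li Mw.
  + apply/subsetP => x /setIP[xL xM]; case/eqP: LM; exact: (bars_vdisjoint Li Mj xL xM).
- move=> L M e /setUP[Lw|/bigcupP[i _ Li]] /setUP[Mw|/bigcupP[j _ Mj]] eL eM.
  + exact: (link_edges wl) eL eM.
  + by case/imsetP: Lw => d dH E; subst L; case: (bar_wall_edges Mj dH eM eL).
  + by case/imsetP: Mw => d dH E; subst M; case: (bar_wall_edges Li dH eL eM).
  + have [x [y [_ eE]]] := edge_pair eL.
    have xe : x \in e by rewrite eE set21.
    by apply: (bars_vdisjoint Li Mj); apply: incident_in_vset xe.
- move=> e; rewrite o1 in_eset_union => /orP[/(link_cover wl)[L Lw eL]|].
    by exists L => //; rewrite inE Lw.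
  case/bigcupP => _ /imsetP[i _ ->] /bigcupP[P Pi eP]; exists P => //.
  by rewrite inE; apply/orP; right; apply/bigcupP; exists i.
Qed.

Lemma wall_path_not_bar i P : P \in Ps i -> P \notin wall_paths.
Proof.
move=> Pi; apply/imsetP => -[e eH E].
have [g ge] : exists g, g \in eset P.
  apply: (link_nonempty graph_links); rewrite inE; apply/orP; right.
  by apply/bigcupP; exists i.
by apply: (bar_wall_edges Pi eH ge); rewrite -E.
Qed.

(* A chain is a set of wall edges and handles; [d] is its boundary modulo 2. *)
Definition chain (f : {set U} -> bool) (q : pred (sgraph V)) (d : pred U) : Prop :=
  [/\ forall P, q P -> P \in Hd, forall u, d u -> row_end u &
  forall u, odd_at H f u =
    \big[addb/false]_P (q P && ((u == fl P) (+) (u == fr P))) (+) d u].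

Definition chain_value (q : pred (sgraph V)) (d : pred U) n :=
  below lo hi q n (+) \big[addb/false]_u (d u && (bpos u < n)).

Definition avoids (f : {set U} -> bool) C : Prop :=
  forall e u, e \in eset H -> u \in e -> sd u \in vset C -> f e = false.

Lemma chain_add f1 q1 d1 f2 q2 d2 : chain f1 q1 d1 -> chain f2 q2 d2 ->
  chain (fun e => f1 e (+) f2 e) (fun P => q1 P (+) q2 P) (fun u => d1 u (+) d2 u).
Proof.
case=> h1 h2 h3 [g1 g2 g3]; split.
- by move=> P; case: (boolP (q1 P)) => [/h1//|_] /= /g1.
- by move=> u; case: (boolP (d1 u)) => [/h2//|_] /= /g2.
move=> u; rewrite /odd_at; under eq_bigr do rewrite andb_addl.
under [in RHS]eq_bigr do rewrite andb_addl.
by rewrite !big_split /= -!/(odd_at H _ u) h3 g3 addbACA.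
Qed.

Lemma chain_row_end f q d u : chain f q d -> odd_at H f u -> row_end u.
Proof.
case=> h1 h2 ->; case: (boolP (d u)) => [/h2//|_]; rewrite addbF => h.
apply: contraTT h => uE; rewrite big1 // => P _; case: (boolP (q P)) => //= /h1/bigcupP[i _ Pi].
have hP := bar_handle Pi.
have -> : (u == fl P) = false by apply: contraNF uE => /eqP ->; exact: handle_u hP.
by apply: contraNF uE => /eqP ->; exact: handle_v hP.
Qed.

(** [potential_row_end] counts the odd vertices before [u]; the boundary equation of the chain
    rewrites them as handle ends and points of [d]. *)
Lemma chain_potential f q d u : chain f q d -> row_end u -> untouched f u ->
  potential f u = chain_value q d (bpos u).
Proof.
move=> ch uE uf; rewrite (potential_row_end c3) //; last by move=> v; exact: (chain_row_end ch).
case: ch => _ _ E; under eq_bigr do rewrite E andb_addr.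
rewrite big_split /=; congr (_ (+) _); last by apply: eq_bigr => v _; rewrite andbC.
under eq_bigr do rewrite big_distrr /=.
rewrite exchange_big /=; apply: eq_bigr => P _; case: (q P) => /=; last first.
  by rewrite big1 // => v _; rewrite andbF.
under eq_bigr do rewrite andb_addr.
rewrite big_split /=; congr (_ (+) _).
  rewrite (bigD1 (fl P)) //= eqxx andbT big1 ?addbF // => v /negbTE->.
  by rewrite andbF.
rewrite (bigD1 (fr P)) //= eqxx andbT big1 ?addbF // => v /negbTE->.
by rewrite andbF.
Qed.

(** * The handles and wall paths of a cycle *)

Section Cycle.
Variable C : sgraph V.
Hypotheses (hC : is_cycle C) (CG : subgraph C G).

Definition cycle_handles := [set P in Hd | eset P \subset eset C].
Definition cycle_wall e := eset (sd_path S e) \subset eset C.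

Lemma cycle_handles_sub : cycle_handles \subset Hd.
Proof. by apply/subsetP => P; rewrite inE => /andP[]. Qed.

Lemma cycle_handlesI i : Ps i :&: cycle_handles = [set P in Ps i | eset P \subset eset C].
Proof.
apply/setP => P; rewrite !inE; case: (boolP (P \in Ps i)) => //= Pi.
by have -> : P \in Hd by apply/bigcupP; exists i.
Qed.

Lemma cycle_handle_vset P : P \in cycle_handles -> vset P \subset vset C.
Proof.
rewrite inE => /andP[PH PC]; apply: (cycle_links_vset graph_links).
by rewrite !inE PH orbT.
Qed.

Lemma gvalue_wall_path e : e \in eset H -> gvalue gamma (sd_path S e) = 0%R.
Proof.
move=> eH; have [a [b [E aH bH]]] := wall_edge_pair eH; subst e.
have [p pn pN] := sd_path_link eH; apply: o2.
  apply/andP; split; apply/subsetP => x xe; first exact: vset_image_path eH xe.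
  by apply/eset_imageP; exists [set a; b].
split; last first.
  have [g ge] : exists g, g \in eset (sd_path S [set a; b]).
    by apply: (link_nonempty (wall_links W)); apply/imsetP; exists [set a; b].
  by apply/set0Pn; exists g.
exists (sd a), (sd b); split; rewrite ?nail_wall // => x xP xa xb.
rewrite setUid; apply/negP => xN.
have : x \in vset (sd_path S [set a; b]) :&: nails W by rewrite inE xP.
by rewrite pN => /set2P[] E; [rewrite E eqxx in xa|rewrite E eqxx in xb].
Qed.

(** The wall paths in [C] have value 0 by O2, and every other link of [C] is a handle. *)
Lemma gvalue_cycle : gvalue gamma C =
  (\sum_i \sum_(P in Ps i | eset P \subset eset C) gvalue gamma P)%R.
Proof.
rewrite /gvalue (big_cycle_links graph_links _ _ hC CG) /=.
rewrite (exchange_big_dep (fun P => P \in cycle_links (wall_paths :|: Hd) C)) /=; last first.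
  move=> i P _ /andP[Pi PC]; rewrite !inE PC andbT; apply/orP; right.
  by apply/bigcupP; exists i.
apply: eq_bigr => L; rewrite !inE => /andP[/orP[Lw|/bigcupP[i _ Li]] LC].
  rewrite [RHS]big_pred0 => [|i]; last by apply/negP => /andP[/wall_path_not_bar/negP].
  by case/imsetP: Lw => e eH ->; exact: gvalue_wall_path.
by rewrite [RHS](big_pred1 i) // => j; rewrite LC andbT; apply/idP/eqP => [Lj|->//]; exact: bars_inj Lj Li.
Qed.

Section CycleValue.
Hypothesis AC : A (gvalue gamma C).

(** Otherwise the value of [C] would lie in the subgroup that O4 keeps away from [A]. *)
Lemma cycle_meets_bar i : Ps i :&: cycle_handles != set0.
Proof.
apply/negP => /eqP E; apply: (o4 (i := i) _ AC); rewrite gvalue_cycle.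
apply: generated_sum => j _; apply: generated_sum => P /andP[Pj PC].
move=> K _ _; apply; exists j, P; split=> //.
apply: contraTneq Pj => ->; apply/negP => Pi.
have : P \in Ps i :&: cycle_handles by rewrite cycle_handlesI inE Pi.
by rewrite E inE.
Qed.

Lemma cycle_bar_parity i :
  pairwiseb (series_pair lo hi) (Ps i) \/ odd #|Ps i :&: cycle_handles|.
Proof.
(* O5 is applied to the indicator function of the handles of [C]. *)
pose f P : int := Posz (eset P \subset eset C).
have fE : gvalue gamma C = (\sum_(j < t) \sum_(P in Ps j) gvalue gamma P *~ f P)%R.
  rewrite gvalue_cycle; apply: eq_bigr => j _; rewrite big_mkcondr /=.
  by apply: eq_bigr => P _; rewrite /f; case: (_ \subset _).
have := AC; rewrite fE => /o5 /(_ i)[/in_seriesE|]; first by left.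
move=> odd_f; right; move: odd_f.
rewrite /f -(big_morph Posz PoszD (erefl (Posz 0))) absz_nat cycle_handlesI -sum1_card.
congr (is_true (odd _)); rewrite big_mkcond /= [RHS]big_mkcond /=.
by apply: eq_bigr => P _; rewrite inE; case: (P \in Ps i) => //=; case: (_ \subset _).
Qed.

End CycleValue.

(** At each nail the number of links of [C] is even by [even_cycle_links]; separating wall paths
    from handles gives the boundary equation. *)
Lemma cycle_chain : chain cycle_wall (mem cycle_handles) pred0.
Proof.
split=> // [P|u]; first exact: (subsetP cycle_handles_sub).
rewrite addbF big_addb_mem; case: (boolP (u \in vset H)) => uH; last first.
  rewrite /odd_at !big1 // => [P PC|e eH].
    have /bigcupP[i _ Pi] := subsetP cycle_handles_sub _ PC; have hP := bar_handle Pi.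
    have -> : (u == fl P) = false by apply: contraNF uH => /eqP ->; exact: handle_uH hP.
    by apply: contraNF uH => /eqP ->; exact: handle_vH hP.
  suff -> : (u \in e) = false by rewrite andbF.
  by apply: contraNF uH; exact: wall_edge_sub.
have := even_cycle_links graph_links hC CG (nail_wall uH).
set N := #|_|; suff -> : odd N = odd_at H cycle_wall u (+)
  \big[addb/false]_(P in cycle_handles) ((u == fl P) (+) (u == fr P)).
  by case: odd_at; case: (\big[_/_]_(P in _) _).
have -> : odd N = \big[addb/false]_(L in cycle_links (wall_paths :|: Hd) C) (sd u \in vset L).
  rewrite odd_card_addb [RHS]big_mkcond /=; apply: eq_bigr => L _.
  by case: (L \in _).
rewrite (big_setID wall_paths) /=; congr (_ (+) _).
  have -> : cycle_links (wall_paths :|: Hd) C :&: wall_paths =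
      [set sd_path S e | e in [set e in eset H | cycle_wall e]].
    apply/setP => L; rewrite !inE; apply/idP/imsetP => [|[e]].
      by case/andP=> /andP[_ LC] /imsetP[e eH E]; exists e; rewrite // inE eH /cycle_wall -E.
    rewrite inE => /andP[eH eC] ->; have -> : sd_path S e \in wall_paths by apply: imset_f.
    by rewrite andbT; exact: eC.
  rewrite big_imset /=; last first.
    by move=> e f /setIdP[eH _] /setIdP[fH _]; exact: sd_path_inj.
  rewrite big_mkcond /= /odd_at [RHS]big_mkcond /=; apply: eq_bigr => e _.
  rewrite inE; case: (boolP (e \in eset H)) => //= eH; case: (cycle_wall e) => //=.
  by rewrite mem_sd_path.
apply: eq_big => [P|P].
  rewrite !inE; case: (boolP (P \in Hd)) => [/bigcupP[i _ Pi]|_]; last first.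
    by rewrite orbF; case: (_ \in _).
  by rewrite (wall_path_not_bar Pi) orbT.
rewrite !inE => /andP[nw /andP[/orP[Pw|/bigcupP[i _ Pi]] _]]; first by rewrite Pw in nw.
have hP := bar_handle Pi; have [l rr] := handle_end_mem hP.
have neq : fl P != fr P by apply: contraTneq (bar_lohi Pi) => E; rewrite /lo /hi E ltnn.
apply/idP/idP => [/(handle_mem_end hP uH)[]->|]; rewrite ?eqxx ?(negbTE neq) ?addbF //.
  by rewrite eq_sym (negbTE neq).
case: (eqVneq u (fl P)) => [->//|_]; case: (eqVneq u (fr P)) => [->//|_].
by [].
Qed.

(** [C] is connected: between the ends of a wall path the potential keeps its value by
    [potential_edge], and across a handle it does so by hypothesis. *)
Lemma chain_value_const f q d : chain f q d -> avoids f C ->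
  (forall i P, P \in Ps i -> sd (fl P) \in vset C -> sd (fr P) \in vset C ->
     chain_value q d (lo P) = chain_value q d (hi P)) ->
  forall u v, row_end u -> row_end v -> sd u \in vset C -> sd v \in vset C ->
  chain_value q d (bpos u) = chain_value q d (bpos v).
Proof.
move=> ch av bars u v uE vE uC vC.
have un w : sd w \in vset C -> untouched f w by move=> wC e eH we; exact: av eH we wC.
have uH := row_end_wall uE; have vH := row_end_wall vE.
pose K x := exists2 w, w \in vset H & x = sd w /\ potential f w = potential f u.
suff : K (sd v).
  case=> w wH [/sd_inj vw]; rewrite -vw // (chain_potential ch vE (un _ vC)).
  by rewrite (chain_potential ch uE (un _ uC)).
apply: (connected_links graph_links (cycle_connected hC) CG (K := K) _
   (nail_wall uH) (nail_wall vH) uC vC); last by exists u.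
move=> L x y LL xL yL /nailP[a aH xa] /nailP[b bH yb] xC yC.
subst x y; case=> a' a'H [/sd_inj aa' Ka]; move: Ka; rewrite -aa' // => Ka {a' a'H aa'}.
exists b => //; split=> //; rewrite -Ka {Ka}.
case/setUP: LL => [/imsetP[e eH E]|/bigcupP[i _ Li]].
  subst L; rewrite !mem_sd_path // in xL yL.
  have [p [p' [E pH pH']]] := wall_edge_pair eH; subst e.
  have pp : sd p \in vset C -> sd p' \in vset C -> potential f p = potential f p'.
    by move=> pC pC'; apply: (potential_edge c3 _ eH); [move=> w; exact: (chain_row_end ch)|exact: un|exact: un].
  by case/set2P: xL => xE; case/set2P: yL => yE; subst a b => //; rewrite pp.
have hL := bar_handle Li.
have pp : sd (fl L) \in vset C -> sd (fr L) \in vset C ->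
    potential f (fl L) = potential f (fr L).
  move=> lC rC; rewrite !(chain_potential ch) ?(handle_u hL) ?(handle_v hL) //; try exact: un.
  exact: bars Li lC rC.
have := handle_mem_end hL aH xL; have := handle_mem_end hL bH yL.
by move=> [] yE [] xE; subst a b => //; rewrite pp.
Qed.

(** The arc is grown from [a] one link at a time, modulo 2: each new link is toggled. Only the
    boundary and the support on [C] matter, so simplicity of the arc is never asked for. *)
Lemma cycle_arc a b : row_end a -> row_end b -> sd a \in vset C -> sd b \in vset C ->
  exists f q, [/\ chain f q (fun u => (u == a) (+) (u == b)),
    forall e u, e \in eset H -> f e -> u \in e -> sd u \in vset C &
    forall P, q P -> sd (fl P) \in vset C].
Proof.
move=> aE bE aC bC; have aH := row_end_wall aE; have bH := row_end_wall bE.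
(* The point [w] reached so far is an arbitrary nail, so the clause of [chain] that boundary points
   are row ends has to wait until [w] is [b]. *)
pose K x := exists2 w, w \in vset H & x = sd w /\
  exists (f : {set U} -> bool) (q : pred (sgraph V)), [/\
    forall P, q P -> P \in Hd,
    forall u, odd_at H f u =
    \big[addb/false]_P (q P && ((u == fl P) (+) (u == fr P))) (+) ((u == a) (+) (u == w)),
    forall e u, e \in eset H -> f e -> u \in e -> sd u \in vset C &
    forall P, q P -> sd (fl P) \in vset C].
suff : K (sd b).
  case=> w wH [/sd_inj bw]; rewrite -bw // => -[f [q [h1 h2 h3 h4]]].
  exists f, q; split=> //; split=> // u.
  by case: (eqVneq u a) => [->//|_]; case: (eqVneq u b) => [->|].
apply: (connected_links graph_links (cycle_connected hC) CG (K := K) _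
   (nail_wall aH) (nail_wall bH) aC bC); last first.
  exists a => //; split=> //; exists (fun=> false), pred0; split=> // u.
  by rewrite /odd_at !big1 // addbb.
move=> L x y LL xL yL /nailP[v vH xv] /nailP[w wH yw] xC yC.
subst x y; case=> v' v'H [/sd_inj vv' Kv]; move: Kv; rewrite -vv' // => -[f [q [h1 h2 h3 h4]]] {v' v'H vv'}.
exists w => //; split=> //.
case: (eqVneq v w) => [vw|vw]; first by subst w; exists f, q.
case/setUP: LL => [/imsetP[e eH E]|/bigcupP[i _ Li]].
  subst L; rewrite !mem_sd_path // in xL yL.
  have eE : e = [set v; w].
    apply/esym/eqP; rewrite eqEcard cards2 vw; have [-> _] := edgeP eH; rewrite andbT.
    by apply/subsetP => z /set2P[]->.
  exists (fun g => f g (+) (g == e)), q; split=> // [u|g u gH]; last first.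
    by case: (eqVneq g e) => [-> _|_]; [rewrite eE => /set2P[]->|rewrite addbF; exact: h3].
  rewrite /odd_at; under eq_bigr do rewrite andb_addl; rewrite big_split /= -/(odd_at H f u).
  have -> : \big[addb/false]_(g in eset H) ((g == e) && (u \in g)) = (u \in e).
    by rewrite (bigD1 e) //= eqxx /= big1 ?addbF // => g /andP[_ /negbTE->].
  rewrite h2 eE !inE; case: (eqVneq u v) => [->|_] /=; rewrite ?(negbTE vw) -?addbA; congr (_ (+) _);
    by case: (_ == a); case: (_ == w).
have hL := bar_handle Li; have lr : fl L != fr L.
  by apply: contraTneq (bar_lohi Li) => E; rewrite /lo /hi E ltnn.
have vwE u : (u == fl L) (+) (u == fr L) = (u == v) (+) (u == w).
  have := handle_mem_end hL vH xL; have := handle_mem_end hL wH yL.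
  move=> [] yE [] xE; subst v w; rewrite ?eqxx // in vw *; exact: addbC.
exists f, (fun P => q P (+) (P == L)); split=> // [P|u|P].
- by case: (eqVneq P L) => [-> _|_]; [apply/bigcupP; exists i|rewrite addbF; exact: h1].
- under eq_bigr do rewrite andb_addl; rewrite big_split /= h2.
  have -> : \big[addb/false]_P ((P == L) && ((u == fl P) (+) (u == fr P))) =
      (u == fl L) (+) (u == fr L).
    by rewrite (bigD1 L) //= eqxx /= big1 ?addbF // => P /negbTE->.
  rewrite vwE -addbA; congr (_ (+) _).
  by case: (u == a); case: (u == v); case: (u == w).
- case: (eqVneq P L) => [-> _|_]; last by rewrite addbF; exact: h4.
  case: (handle_mem_end hL vH xL) => [<-//|vr].
  case: (handle_mem_end hL wH yL) => [<-//|wr].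
  by rewrite vr wr eqxx in vw.
Qed.

End Cycle.

(** * Two disjoint cycles *)

Section TwoCycles.
Variables C D : sgraph V.
Hypotheses (hC : is_cycle C) (CG : subgraph C G) (hD : is_cycle D) (DG : subgraph D G).
Hypothesis CD : vdisjoint C D.

Lemma cycle_wall_avoids : avoids (cycle_wall C) D.
Proof.
move=> e u eH ue uD; apply/negP => eC.
have : vset (sd_path S e) \subset vset C.
  by apply: (cycle_links_vset graph_links); rewrite !inE imset_f.
move/subsetP/(_ (sd u)); rewrite mem_sd_path ?(wall_edge_sub eH ue) // => /(_ ue) uC.
by have := disjointFr CD uC; rewrite uD.
Qed.

Lemma cycle_handles_disjoint : [disjoint cycle_handles C & cycle_handles D].
Proof.
apply/pred0P => P /=; apply/negP => /andP[PC PD].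
have /bigcupP[i _ Pi] := subsetP (cycle_handles_sub C) _ PC.
have [l _] := handle_end_mem (bar_handle Pi).
have := disjointFr CD (subsetP (cycle_handle_vset PC) _ l).
by rewrite (subsetP (cycle_handle_vset PD) _ l).
Qed.

(** Pair the potential of [C] with the boundary of the wall part of [D]. The potential does not
    change along wall edges of [D], so the pairing is 0. The boundary consists of handle ends of
    [D], so the pairing also adds up the jumps across these handles, which count crossings. *)
Lemma cycle_handles_cross : 
  \big[addb/false]_(P in cycle_handles D) \big[addb/false]_(Q in cycle_handles C)
     cross lo hi P Q = false.
Proof.
have chC := cycle_chain hC CG; have chD := cycle_chain hD DG.
have un u : sd u \in vset D -> untouched (cycle_wall C) u.
  by move=> uD e eH ue; exact: cycle_wall_avoids eH ue uD.
have E0 : \big[addb/false]_u (potential (cycle_wall C) u && odd_at H (cycle_wall D) u) = false.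
  rewrite sum_odd_at big1 // => e eH; case: (boolP (cycle_wall D e)) => //= eD.
  have [a [b [eE aH bH]]] := wall_edge_pair eH; subst e.
  have sub : vset (sd_path S [set a; b]) \subset vset D.
    by apply: (cycle_links_vset graph_links); rewrite !inE imset_f.
  have aD : sd a \in vset D by apply: (subsetP sub); rewrite mem_sd_path ?set21.
  have bD : sd b \in vset D by apply: (subsetP sub); rewrite mem_sd_path ?set22.
  have ab : a != b.
    by apply/eqP=> ab; have [] := edgeP eH; rewrite ab setUid cards1.
  rewrite big_addb_set2 // (potential_edge c3 _ eH) ?addbb //; try exact: un.
  by move=> v; exact: (chain_row_end chC).
rewrite -[RHS]E0; case: chD => _ _ ED; under [RHS]eq_bigr do rewrite ED addbF big_distrr /=.
rewrite [RHS]exchange_big /= -[LHS]big_addb_mem; apply: eq_bigr => P _.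
case: (boolP (P \in cycle_handles D)) => /= PD; last by rewrite big1 // => u _; rewrite andbF.
have /bigcupP[i _ Pi] := subsetP (cycle_handles_sub D) _ PD.
have hP := bar_handle Pi; have [l rr] := handle_end_mem hP.
have /subsetP sub := cycle_handle_vset PD.
under [RHS]eq_bigr do rewrite andb_addr; rewrite [RHS]big_split /=.
rewrite (bigD1 (fl P)) //= eqxx andbT [X in (_ (+) X) (+) _]big1 => [|v /negbTE->]; last by rewrite andbF.
rewrite [X in _ (+) X](bigD1 (fr P)) //= eqxx andbT [X in _ = _ (+) (_ (+) X)]big1 => [|v /negbTE->]; last by rewrite andbF.
rewrite !addbF !(chain_potential chC) ?(handle_u hP) ?(handle_v hP) //; try by apply: un; exact: sub.
rewrite /chain_value -below_cross_set.
by rewrite ![\big[addb/false]_(u : U) _]big1 ?addbF.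
Qed.

End TwoCycles.

(** Disjoint cycles use different handles of [Ps i]; this supplies the second handle that
    [series_side] asks for. *)
Lemma cycles_bar_gt1 C D i : is_cycle C -> subgraph C G -> is_cycle D -> subgraph D G ->
  vdisjoint C D -> A (gvalue gamma C) -> A (gvalue gamma D) -> 1 < #|Ps i|.
Proof.
move=> hC CG hD DG CD AC AD.
have /set0Pn[P /setIP[Pi PC]] := cycle_meets_bar hC CG AC i.
have /set0Pn[Q /setIP[Qi QD]] := cycle_meets_bar hD DG AD i.
apply/card_gt1P; exists P, Q; split=> //; apply: contraTneq QD => <-.
by rewrite (disjointFr (cycle_handles_disjoint CD) PC).
Qed.

Lemma chain_value_pair q a b n :
  chain_value q (fun u => (u == a) (+) (u == b)) n =
  below lo hi q n (+) ((bpos a < n) (+) (bpos b < n)).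
Proof.
rewrite /chain_value; congr (_ (+) _); under eq_bigr do rewrite andb_addl.
rewrite big_split /=; congr (_ (+) _).
  by rewrite (bigD1 a) //= eqxx big1 ?addbF // => u /negbTE->.
by rewrite (bigD1 b) //= eqxx big1 ?addbF // => u /negbTE->.
Qed.

(** With [h i] on [C] and [g i] on [D], the potential of an arc of [D] from [g a] to [g b] is
    constant on [C]. The handles of the arc contribute nothing at handle ends on [C], so only the
    comparisons with the two arc ends remain, as [no_three_series] requires. *)
Lemma two_cycles_not_all_series C D : is_cycle C -> subgraph C G ->
  is_cycle D -> subgraph D G -> vdisjoint C D ->
  A (gvalue gamma C) -> A (gvalue gamma D) -> 2 < t ->
  ~ (forall i, pairwiseb (series_pair lo hi) (Ps i)).
Proof.
move=> hC CG hD DG CD AC AD t3 ser.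
have c1 i := cycles_bar_gt1 i hC CG hD DG CD AC AD.
have repC i : {P | P \in Ps i :&: cycle_handles C}.
  exact/sigW/set0Pn/cycle_meets_bar.
have repD i : {P | P \in Ps i :&: cycle_handles D}.
  exact/sigW/set0Pn/cycle_meets_bar.
pose h i := sval (repC i); pose g i := sval (repD i).
have hP i : h i \in Ps i by have /setIP[] := svalP (repC i).
have gP i : g i \in Ps i by have /setIP[] := svalP (repD i).
have hlC i : sd (fl (h i)) \in vset C.
  have /setIP[_ /cycle_handle_vset/subsetP] := svalP (repC i); apply.
  by case: (handle_end_mem (bar_handle (hP i))).
have glD i : sd (fl (g i)) \in vset D.
  have /setIP[_ /cycle_handle_vset/subsetP] := svalP (repD i); apply.
  by case: (handle_end_mem (bar_handle (gP i))).
have nCD x : x \in vset C -> x \in vset D -> False.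
  by move=> xC; rewrite (disjointFr CD xC).
have lt0 : 0 < t by lia. have lt1 : 1 < t by lia.
apply: (@no_three_series _ _ _ lo hi bar_lohi bar_ends_neq bars_inj bars_side
  (Ordinal lt0) (Ordinal lt1) (Ordinal t3) h g ser c1) => // a b k l.
have uE i : row_end (fl (g i)) by exact: handle_u (bar_handle (gP i)).
have [f [q [ch fD qD]]] := cycle_arc hD DG (uE a) (uE b) (glD a) (glD b).
have nq P : sd (fl P) \in vset C -> ~~ q P.
  by move=> PC; apply/negP => /qD; exact: nCD.
have qH P : q P -> P \in \bigcup_i Ps i by case: ch => + _ _; exact.
have b0 i P n : P \in Ps i -> sd (fl P) \in vset C -> n = lo P \/ n = hi P ->
    below lo hi q n = false.
  move=> Pi PC nP; apply: (all_series_below bar_lohi bar_ends_neq bars_side ser c1 Pi) nP => //.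
  exact: nq.
have := chain_value_const hC CG ch _ _ (handle_u (bar_handle (hP k)))
  (handle_u (bar_handle (hP l))) (hlC k) (hlC l).
have bh m : below lo hi q (bpos (fl (h m))) = false by apply: (b0 m (h m)) => //; left.
rewrite !chain_value_pair !bh !addFb; apply=> [e u eH ue uC|i P Pi lC rC].
  by apply/negP => fe; exact: (nCD _ uC (fD e u eH fe ue)).
(* There is no jump across a handle [P] with ends on [C] either: no [lo (g m)] lies between these
   ends. *)
rewrite !chain_value_pair (b0 i P (lo P)) ?(b0 i P (hi P)) //; [|by right|by left].
have nb m : (lo (g m) < lo P) = (lo (g m) < hi P).
  apply: (all_series_not_between bar_lohi bars_side ser c1 (gP m) Pi); last by left.
  by apply/eqP => E; apply: nCD lC _; rewrite -E.
by congr (_ (+) (_ (+) _)); exact: nb.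
Qed.

(** If O6b fails, all handlebars are in series or none is. The first case leaves O6c, hence three
    handlebars; the second leaves O6a, against the even number of crossings. *)
Lemma two_cycles_O6b C D : is_cycle C -> subgraph C G ->
  is_cycle D -> subgraph D G -> vdisjoint C D ->
  A (gvalue gamma C) -> A (gvalue gamma D) ->
  [\/ O6a W Ps, O6b W Ps | O6c W Ps] -> O6b W Ps.
Proof.
move=> hC CG hD DG CD AC AD o6; apply: contrapT => no6b.
have c1 i := cycles_bar_gt1 i hC CG hD DG CD AC AD.
case: (pselect (forall i, in_series W (Ps i))) => ser.
  have serb i : pairwiseb (series_pair lo hi) (Ps i) by apply/in_seriesE.
  have t2 : ~ 2 < t.
    by move=> t2; exact: (two_cycles_not_all_series hC CG hD DG CD AC AD t2 serb).
  case: o6 => // [|o6c]; last first.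
    by apply: t2; apply: leq_trans o6c _; rewrite -[X in _ <= X]card_ord max_card.
  (* Having two handles, a handlebar in series cannot be crossing as well, so O6a would count an
     empty set. *)
  rewrite /O6a eq_card0 // => i; rewrite inE; apply/asboolP => /crossingE/pairwisebP cr.
  have /card_gt1P[P [Q [Pi Qi PQ]]] := c1 i.
  have := cr _ _ Pi Qi PQ; move/pairwisebP: (serb i) => /(_ _ _ Pi Qi PQ).
  by rewrite /crossing_pair => ->.
have nser i : ~ in_series W (Ps i).
  by move=> si; apply: no6b; split=> //; exists i.
case: o6 => // [|o6c]; last first.
  by move: o6c; rewrite /O6c eq_card0 // => i; rewrite inE; apply/asboolP; exact: nser.
have odd_bar E : is_cycle E -> subgraph E G -> A (gvalue gamma E) ->
    forall i, odd #|Ps i :&: cycle_handles E|.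
  move=> hE EG AE i; case: (cycle_bar_parity hE EG AE i) => // s.
  by case: (nser i); apply/in_seriesE.
have DC : vdisjoint D C by rewrite /vdisjoint disjoint_sym.
have := cycle_handles_cross hC CG hD DG CD.
rewrite (sum_cross_crossing bar_lohi bar_ends_neq bars_inj bars_side bars_pure)
  ?cycle_handles_sub ?cycle_handles_disjoint //; try exact: odd_bar.
move=> ev; rewrite /O6a => od; move: ev; rewrite (_ : [set _ | _] = [set i | `[< crossing W (Ps i) >]]) ?od //.
by apply/setP => i; rewrite !inE; apply/idP/asboolP => /crossingE.
Qed.

(** The potential of the sum of [C] and [D] is constant along [E]: at a handle with both ends on [E]
    the two summands jump alike by [cross_two_sets]. *)
Lemma cycle_sides C D E : is_cycle C -> subgraph C G -> is_cycle D -> subgraph D G ->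
  is_cycle E -> subgraph E G -> vdisjoint C E -> vdisjoint D E ->
  (forall i, 1 < #|Ps i|) -> A (gvalue gamma C) -> A (gvalue gamma D) ->
  forall P P', P \in cycle_handles E -> P' \in cycle_handles E ->
  below lo hi (mem (cycle_handles C)) (lo P) (+) below lo hi (mem (cycle_handles D)) (lo P) =
  below lo hi (mem (cycle_handles C)) (lo P') (+) below lo hi (mem (cycle_handles D)) (lo P').
Proof.
move=> hC CG hD DG hE EG CE DE c1 AC AD.
have ch := chain_add (cycle_chain hC CG) (cycle_chain hD DG).
have valE n : chain_value (fun P => mem (cycle_handles C) P (+) mem (cycle_handles D) P)
    (fun u => pred0 u (+) pred0 u) n =
    below lo hi (mem (cycle_handles C)) n (+) below lo hi (mem (cycle_handles D)) n.
  rewrite /chain_value [X in _ (+) X]big1 ?addbF // /below -big_split.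
  by apply: eq_bigr => P _; rewrite andb_addl.
have end_in P : P \in cycle_handles E -> row_end (fl P) /\ sd (fl P) \in vset E.
  move=> PE; have /bigcupP[i _ Pi] := subsetP (cycle_handles_sub E) _ PE.
  have hP := bar_handle Pi; split; first exact: handle_u hP.
  by apply: (subsetP (cycle_handle_vset PE)); case: (handle_end_mem hP).
have notin F P i : vdisjoint F E -> P \in Ps i -> sd (fl P) \in vset E -> P \notin cycle_handles F.
  move=> FE Pi PE; apply/negP => /cycle_handle_vset/subsetP/(_ (sd (fl P))).
  case: (handle_end_mem (bar_handle Pi)) => -> _ /(_ isT) PF.
  by have := disjointFr FE PF; rewrite PE.
move=> P P' /end_in[PE PiE] /end_in[PE' PiE'].
have := chain_value_const hE EG ch _ _ PE PE' PiE PiE'; rewrite !valE; apply.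
  by move=> e u eH ue uE; rewrite (cycle_wall_avoids CE eH ue uE) (cycle_wall_avoids DE eH ue uE).
move=> i Q Qi lE rE; rewrite !valE.
by apply: (cross_two_sets bar_lohi bar_ends_neq bars_inj bars_side bars_pure (i := i)) => //;
  rewrite ?cycle_handles_sub ?(notin _ _ _ CE Qi lE) ?(notin _ _ _ DE Qi lE) //;
  exact: cycle_bar_parity.
Qed.

Lemma no_three_cycles C D E : is_cycle C -> subgraph C G -> is_cycle D -> subgraph D G ->
  is_cycle E -> subgraph E G -> vdisjoint C D -> vdisjoint C E -> vdisjoint D E ->
  A (gvalue gamma C) -> A (gvalue gamma D) -> A (gvalue gamma E) -> ~ O6b W Ps.
Proof.
move=> hC CG hD DG hE EG CD CE DE AC AD AE [[i si] nall].
have c1 k := cycles_bar_gt1 k hC CG hD DG CD AC AD.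
have [j nj] : exists j, ~ in_series W (Ps j) by exact/existsNP.
have DC : vdisjoint D C by rewrite /vdisjoint disjoint_sym.
have EC : vdisjoint E C by rewrite /vdisjoint disjoint_sym.
have ED : vdisjoint E D by rewrite /vdisjoint disjoint_sym.
have oj F : is_cycle F -> subgraph F G -> A (gvalue gamma F) -> odd #|Ps j :&: cycle_handles F|.
  move=> hF FG AF; case: (cycle_bar_parity hF FG AF j) => // s.
  by case: nj; apply/in_seriesE.
have /in_seriesE sib := si.
have njb : ~~ pairwiseb (series_pair lo hi) (Ps j) by apply/negP => /in_seriesE.
have /set0Pn[P PP] := cycle_meets_bar hC CG AC i.
have /set0Pn[Q QQ] := cycle_meets_bar hD DG AD i.
have /set0Pn[R RR] := cycle_meets_bar hE EG AE i.
apply: (no_three_sets bar_lohi bar_ends_neq bars_side bars_pure sib (c1 i) njb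
  (cycle_handles_sub C) (cycle_handles_sub D) (cycle_handles_sub E)
  (cycle_handles_disjoint CD) (cycle_handles_disjoint CE) (cycle_handles_disjoint DE)
  (oj _ hC CG AC) (oj _ hD DG AD) (oj _ hE EG AE) PP QQ RR).
- exact: (cycle_sides hD DG hE EG hC CG DC EC c1 AD AE).
- exact: (cycle_sides hC CG hE EG hD DG CD ED c1 AC AE).
- exact: (cycle_sides hC CG hD DG hE EG CE DE c1 AC AD).
Qed.

End Witness.

Lemma cell_inhabited (V : finType) (W : wall V) : inhabited ('I_(wcols W).*2 * 'I_(wrows W)).
Proof.
have c0 : 0 < (wcols W).*2 by have := wcols_ge3 W; lia.
have r0 : 0 < wrows W by have := wrows_ge3 W; lia.
by split; exact: (Ordinal c0, Ordinal r0).
Qed.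

Lemma choose_handle_ends (V : finType) (W : wall V) : exists fl fr,
  forall P, handle W P -> handle_from (W := W) P (fl P) (fr P).
Proof.
have [z] := cell_inhabited W.
have ex P : exists uv, handle W P -> handle_from (W := W) P uv.1 uv.2.
  case: (pselect (handle W P)) => [/handle_ends[u [v h]]|nP]; first by exists (u, v).
  (* A dummy value for graphs that are not handles. *)
  by exists (z, z).
have [F FP] := choice ex.
by exists (fun P => (F P).1), (fun P => (F P).2).
Qed.

Theorem proposition8p1 (kappa theta : nat) (kappa_gt0 : 0 < kappa)
    (theta_gt0 : 0 < theta) (Gamma : zmodType) (A : Gamma -> Prop)
    (V : finType) (G : sgraph V) (gamma : {set V} -> Gamma) :
  class_C kappa theta A G gamma ->
  ~ disjoint_A_cycles 3 A G gamma /\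
  (disjoint_A_cycles 2 A G gamma ->
   forall (W : wall V) (t : nat) (Ps : 'I_t -> {set sgraph V}),
     witness kappa theta A G gamma W Ps -> O6b W Ps).
Proof.
have nonempty (t : nat) (Ps : 'I_t -> {set sgraph V}) : (forall i, kappa <= #|Ps i|) ->
    forall i, Ps i != set0.
  by move=> kP i; rewrite -card_gt0; exact: leq_trans kappa_gt0 (kP i).
(* Stated for an arbitrary witness, because the second claim concerns every one of them. *)
have two C D (W : wall V) (t : nat) (Ps : 'I_t -> {set sgraph V}) :
    witness kappa theta A G gamma W Ps ->
    [/\ is_cycle C, subgraph C G & A (gvalue gamma C)] ->
    [/\ is_cycle D, subgraph D G & A (gvalue gamma D)] -> vdisjoint C D -> O6b W Ps.
  case=> _ [_ hb dis nm] [o1 o2 o3 o4 [o5 o6]] [hC CG AC] [hD DG AD] CD.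
  have [fl [fr flr]] := choose_handle_ends W.
  exact: (two_cycles_O6b flr (fun i => proj1 (hb i)) (nonempty _ _ (fun i => proj2 (hb i)))
    dis nm o1 o2 o3 o4 o5 hC CG hD DG CD AC AD o6).
move=> [W [t [Ps wit]]]; split=> [[C [hC CC]]|[C [hC CC]] W' t' Ps' wit']; last first.
  have n01 : ord0 != ord_max :> 'I_2 by [].
  exact: two _ _ _ _ _ wit' (hC _) (hC _) (CC _ _ n01).
pose i0 : 'I_3 := ord0; pose i1 : 'I_3 := lift ord0 ord0; pose i2 : 'I_3 := ord_max.
have [n01 n02 n12] : [/\ i0 != i1, i0 != i2 & i1 != i2].
  by [].
(* Two of the three cycles already force O6b, the case that [no_three_cycles] excludes. *)
have o6b := two _ _ _ _ _ wit (hC i0) (hC i1) (CC _ _ n01).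
have [hC0 G0 A0] := hC i0; have [hC1 G1 A1] := hC i1; have [hC2 G2 A2] := hC i2.
case: wit => _ [_ hb dis nm] [o1 o2 o3 o4 [o5 o6]].
have [fl [fr flr]] := choose_handle_ends W.
exact: (no_three_cycles flr (fun i => proj1 (hb i)) (nonempty _ _ (fun i => proj2 (hb i)))
  dis nm o1 o2 o3 o4 o5 hC0 G0 hC1 G1 hC2 G2 (CC _ _ n01) (CC _ _ n02) (CC _ _ n12) A0 A1 A2 o6b).
Qed.
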